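(* Let $\delta\in(0,1)$. Suppose $G$ is a one-dimensional Gaussian process restricted to $[0,1]$, observed at the points $i/n$, $i=1,\dots,n$, such that $G-\mathbb{E}G$ is stationary with an integrable positive definite covariance function $K$ whose spectral density $\hat K$ satisfies, for some $\nu\in(0,\infty)$, $$C_K:=\sup_{\omega\in\mathbb{R}}\left|\hat K(\omega)(1+\omega^2)^{\nu+1/2}\right|<\infty .$$ Consider the GLRT $T_{GLRT}$ (known covariance, threshold $R_{n,\delta}$) for the shift-in-mean problem described in the context. There exist $R_{n,\delta}>0$ (depending only on $n$ and $\delta$), $n_0=n_0(K)$ and a positive universal constant $C$ such that if $n\ge n_0$ and $$|b|\ge C n^{-\nu}\sqrt{C_K\left(1+\frac1\nu\right)\log\left(\frac{n(1-2\alpha)}{\delta}\right)},$$ then $\varphi_n(T_{GLRT})\le\delta$.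
   Context: Observations: $\boldsymbol X=(X_1,\dots,X_n)^\top$ with $X_k=G(k/n)$, a Gaussian vector with known covariance matrix $\Sigma_n=[K((r-s)/n)]_{r,s=1}^n$. Fourier transform: $\hat K(\omega)=\int_{\mathbb{R}}K(t)e^{-j\omega t}\,dt$ with $j^2=-1$. Testing problem: fix $\alpha\in(0,1/2)$ and let $\mathcal{C}_{n,\alpha}=\{t\in\{1,\dots,n\}: t\wedge(n-t)>\alpha n\}$. For $t\in\mathcal{C}_{n,\alpha}$ let $\zeta_t\in\mathbb{R}^n$ have $\zeta_t(k)=-1$ for $k\le t$ and $\zeta_t(k)=+1$ for $k>t$. The null hypothesis is $\mathbb{H}_0:\mathbb{E}\boldsymbol X=0$; the alternative with change point $t$ and jump $b\neq0$ is $\mathbb{H}_{1,t}:\mathbb{E}\boldsymbol X=\frac b2\zeta_t$ (same covariance). The GLRT with threshold $R_{n,\delta}$ is $$T_{GLRT}=\mathbb{1}\left(\max_{t\in\mathcal{C}_{n,\alpha}}\left|\frac{\zeta_t^\top\Sigma_n^{-1}\boldsymbol X}{\sqrt{\zeta_t^\top\Sigma_n^{-1}\zeta_t}}\right|^2\ge R_{n,\delta}\right).$$ For a test $T\in\{0,1\}$ (a function of $\boldsymbol X$), the conditional detection error probability is $\varphi_n(T)=\mathbb{P}(T=1\mid\mathbb{H}_0)+\max_{t\in\mathcal{C}_{n,\alpha}}\mathbb{P}(T=0\mid\mathbb{H}_{1,t})$, where under $\mathbb{H}_{1,t}$ the jump size is $b$. *)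

(* Defs.v *)
From HB Require Import structures.
From mathcomp Require Import all_boot all_order all_algebra.
From mathcomp Require Import all_classical all_reals all_analysis.
From mathcomp Require Import complex.

Set Implicit Arguments.
Unset Strict Implicit.
Unset Printing Implicit Defensive.

Import Order.TTheory GRing.Theory Num.Theory numFieldNormedType.Exports.

Local Open Scope classical_set_scope.
Local Open Scope ring_scope.

(* Normal law with mean m and standard deviation s, degenerating to a point
   mass at s = 0 (the library's normal_prob m 0 is not the point mass). *)
Definition gaussian_law (R : realType) (m s : R) : set R -> \bar R :=
  if s == 0 then \d_m else normal_prob m s.

Definition gaussian_rv d (T : measurableType d) (R : realType)
    (P : probability T R) (X : T -> R) : Prop :=
  exists m s : R, 0 <= s /\
    forall A : set R, measurable A -> P (X @^-1` A) = gaussian_law m s A.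

(* G is a process on [0, 1]: its values at other times are irrelevant. *)
Definition gaussian_process d (T : measurableType d) (R : realType)
    (P : probability T R) (G : R -> {mfun T >-> R}) : Prop :=
  forall (m : nat) (s a : 'I_m -> R), (forall i, s i \in `[0, 1]) ->
    gaussian_rv P (fun w => \sum_(i < m) a i * G (s i) w).

(* The library's covariance centers its arguments, so this says that
   G - E G is stationary on [0, 1] with covariance function K. *)
Definition stationary_covariance d (T : measurableType d) (R : realType)
    (P : probability T R) (G : R -> {mfun T >-> R}) (K : R -> R) : Prop :=
  forall s t : R, s \in `[0, 1] -> t \in `[0, 1] ->
    covariance P (G s) (G t) = (K (s - t))%:E.

(* Strict positive definiteness: this is what makes every Sigma_n invertible. *)
Definition positive_definite (R : realType) (K : R -> R) : Prop :=
  (forall t, K (- t) = K t) /\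
  forall (m : nat) (s a : 'I_m -> R), injective s -> (exists i, a i != 0) ->
    0 < \sum_(i < m) \sum_(j < m) a i * a j * K (s i - s j).

(* \int K(t) e^{-j w t} dt, split into real and imaginary parts. *)
Definition fourier (R : realType) (K : R -> R) (w : R) : R[i] :=
  Complex (\int[lebesgue_measure]_t (K t * cos (w * t)))
          (- \int[lebesgue_measure]_t (K t * sin (w * t))).

Definition spectral_bound (R : realType) (K : R -> R) (nu : R) : \bar R :=
  ereal_sup (range (fun w : R =>
    (Normc.normc (fourier K w *
       real_complex R ((1 + w ^+ 2) `^ (nu + 2^-1))))%:E)).

(* Coordinates k = 1, ..., n of the paper are k.+1 for k : 'I_n. *)
Definition observations d (T : measurableType d) (R : realType)
    (G : R -> {mfun T >-> R}) (n : nat) (w : T) : 'cV[R]_n :=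
  \col_(k < n) G (k.+1%:R / n%:R) w.

Definition Sigma (R : realType) (K : R -> R) (n : nat) : 'M[R]_n :=
  \matrix_(r < n, s < n) K ((r.+1%:R - s.+1%:R) / n%:R).

Definition zeta (R : realType) (n t : nat) : 'cV[R]_n :=
  \col_(k < n) (if (k.+1 <= t)%N then -1 else 1).
Arguments zeta : clear implicits.

Definition candidate (R : realType) (n : nat) (alpha : R) (t : nat) : bool :=
  [&& (1 <= t)%N, (t <= n)%N & alpha * n%:R < (minn t (n - t))%:R].

Definition glrt_stat (R : realType) (n : nat) (S : 'M[R]_n) (t : nat)
    (x : 'cV[R]_n) : R :=
  `| ((zeta R n t)^T *m invmx S *m x) 0 0 /
     Num.sqrt (((zeta R n t)^T *m invmx S *m zeta R n t) 0 0) | ^+ 2.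

(* The maxima below are over nonnegative values, so the unit 0 only matters
   when there is no candidate change point. *)
Definition glrt (R : realType) (n : nat) (alpha : R) (S : 'M[R]_n) (thr : R)
    (x : 'cV[R]_n) : bool :=
  thr <= \big[Num.max/0]_(t < n.+1 | candidate n alpha t) glrt_stat S t x.

(* P0 is the law of the data under H_0 and P1 t the law under H_{1,t}. *)
Definition detection_error d (T : measurableType d) (R : realType)
    (P0 : probability T R) (P1 : nat -> probability T R) (n : nat) (alpha : R)
    (X : T -> 'cV[R]_n) (test : 'cV[R]_n -> bool) : \bar R :=
  (P0 [set w | test (X w)] +
   \big[maxe/0]_(t < n.+1 | candidate n alpha t)
     P1 t [set w | ~~ test (X w)])%E.

(* Main.v *)
Require Import Defs.
From HB Require Import structures.
From mathcomp Require Import all_boot all_order all_algebra.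
From mathcomp Require Import all_classical all_reals all_analysis.
From mathcomp Require Import complex ring lra zify measurable_realfun.

Set Implicit Arguments.
Unset Strict Implicit.
Unset Printing Implicit Defensive.

Import Order.TTheory GRing.Theory Num.Theory numFieldNormedType.Exports.

Local Open Scope classical_set_scope.
Local Open Scope ring_scope.

(** Write $S$ for the covariance matrix of the observations, $z_t$ for the sign
    vector of a jump at $t$ and $q_t = z_t^T S^{-1} z_t$. The statistic at $t$
    is the square of the score $z_t^T S^{-1} X/\sqrt{q_t}$, a Gaussian variable
    of variance $1$ which is centred under the null hypothesis and has mean
    $\frac b2\sqrt{q_t}$ after a jump at $t$. With a threshold proportional to
    $\log(4(n+1)/\delta)$, a union bound over $t$ controls the false alarms
    ([glrt_false_alarm_le]), and a miss at $t$ is a large deviation of one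
    score as soon as $b^2 q_t$ is a large multiple of the threshold
    ([glrt_miss_le]). Everything therefore rests on a lower bound for the
    information $q_t$, namely
    $n^{2\nu} \le 9\,C_K(1+1/\nu)\,q_t$ ([information_ge]).

    By duality $q_t \ge (v^T z_t)^2/v^T S v$ for every $v$
    ([dot_sqr_le_quad]), so a single good test vector suffices. It is a
    difference of order $M = 2m+1$ with $m-1 \le \nu < m$, with weights
    $(-1)^j\binom Mj$, centred at the jump. The alternating partial sums of
    binomials telescope, so $|v^T z_t| = 2\binom{2m}m$, which is at least
    $2\cdot 4^m/(2m+1)$. On the spectral side the difference is a filter of gain
    $|2\sin(\omega/2n)|^M$, at most $2^M$ and at most $(\omega/n)^M$: since $M$
    exceeds $\nu + 1/2$, it removes the frequencies below $2n$, on the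
    others the hypothesis on the spectral density applies, and
    $v^T S v \le C_K 4^M (2n)^{-2\nu}(1+1/(2\nu))$
    ([finite_difference_variance_le]). The constant stays universal although
    the order grows with $\nu$, because the factor $(2m+1)^2$ lost in the
    binomial coefficient is paid for by the $4^{-\nu}$ contained in
    $(2n)^{-2\nu}$. The support of $v$ has to fit between the ends of the
    sample, which is why $n$ must be large.

    Bounding $v^T S v$ by the spectral density is Fourier inversion at one
    point, in the one-sided form: if $h$ dominates the cosine transform of $f$
    then $f(0) \le \int_0^\infty h$ ([fourier_inversion_le]). It is
    obtained by Abel summation: damping by $e^{-\varepsilon\omega}$ turns the
    inversion integral into the average of $f$ against the kernel
    $\varepsilon/(\varepsilon^2+y^2)$. The lost factor $\pi$ goes into the
    constant.

    A Gaussian variable is given here by some normal law and by its mean and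
    variance, so the parameters of the law have to be related to the moments.
    Up to constant factors this follows from Chebyshev's inequality and from
    elementary bounds on the normal density ([gaussian_concentration]), which
    is again enough for a universal constant. *)

(** * Translation invariance and Abel summation *)

Section Fourier.
Context {R : realType}.
Notation mu := (@lebesgue_measure R).

Lemma ge0_integral_shift (f : R -> R) (a : R) :
  continuous f -> (forall x, 0 <= f x) ->
  (\int[mu]_x (f (x + a))%:E = \int[mu]_x (f x)%:E)%E.
Proof.
move=> cf f0.
have dF (x : R) : derivable (fun x : R => x + a) x 1 by [].
have F' : (fun x : R => x + a)^`()%classic = cst 1.
  apply/funext => x; rewrite derive1E deriveD// derive_id derive_cst addr0//.
have h1 : {homo (fun x : R => x + a) : x y / x < y}.
  by move=> x y xy; rewrite ltrD2r.
have h2 : continuous ((fun x : R => x + a)^`()%classic).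
  by rewrite F' => x; exact: cvg_cst.
have h3 : cvg ((fun x : R => x + a)^`()%classic x @[x --> -oo]).
  by rewrite F'; exact: is_cvg_cst.
have h4 : cvg ((fun x : R => x + a)^`()%classic x @[x --> +oo]).
  by rewrite F'; exact: is_cvg_cst.
have h5 : (fun x : R => x + a) x @[x --> -oo] --> -oo by exact: cvg_addrr_Ny.
have h6 : (fun x : R => x + a) x @[x --> +oo] --> +oo by exact: cvg_addrr.
rewrite [RHS](increasing_ge0_integration_by_substitutionT h1 h2 h3 h4 dF h5 h6 cf f0).
by apply: eq_integral => x _; rewrite F' /= fctE mulr1.
Qed.

Lemma continuous_shift (f : R -> R) (u : R) :
  continuous f -> continuous (fun y => f (y + u)).
Proof.
move=> cf y; apply: (@continuous_comp _ _ _ (fun x => x + u) f); last exact: cf.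
by apply: cvgD; [exact: cvg_id|exact: cvg_cst].
Qed.

Lemma integrable_shift (f : R -> R) (a : R) : continuous f ->
  mu.-integrable setT (EFin \o f) ->
  mu.-integrable setT (EFin \o (fun x => f (x + a))).
Proof.
move=> cf /integrableP[mf fi].
apply/integrableP; split.
  apply/measurable_EFinP; apply: continuous_measurable_fun.
  exact: continuous_shift.
have cn : continuous (fun x => `|f x|) by move=> x; apply: cvg_norm; exact: cf.
have n0 (x : R) : 0 <= `|f x| by [].
by rewrite [ltLHS](ge0_integral_shift a cn n0).
Qed.

(** The case of a sign-changing $f$ follows from the nonnegative one applied to
    $f+|f|$ and $|f|$. *)
Lemma Rintegral_shift (f : R -> R) (a : R) : continuous f ->
  mu.-integrable setT (EFin \o f) ->
  \int[mu]_x f (x + a) = \int[mu]_x f x.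
Proof.
move=> cf fi.
have n0 (x : R) : 0 <= f x + `|f x|.
  by rewrite -lerBlDl sub0r -normrN ler_norm.
have cn : continuous (fun x => `|f x|) by move=> x; apply: cvg_norm; exact: cf.
have c2 : continuous (fun x => f x + `|f x|).
  by move=> x; apply: cvgD; [exact: cf|exact: cn].
have := ge0_integral_shift a c2 n0.
have /= := ge0_integral_shift a cn (fun x => normr_ge0 _).
have fai := integrable_shift a cf fi.
have ni := integrable_norm fi.
have nai := integrable_norm fai.
move=> /(congr1 fine) E1 /(congr1 fine) E2.
have : \int[mu]_x (f (x + a) + `|f (x + a)|) = \int[mu]_x (f x + `|f x|) by exact: E2.
rewrite !RintegralD//.
have -> : \int[mu]_x `|f (x + a)| = \int[mu]_x `|f x| by exact: E1.
exact: addIr.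
Qed.

Lemma normr_sin_le1 (x : R) : `|sin x| <= 1.
Proof. by rewrite ler_norml sin_geN1 sin_le1. Qed.

Lemma normr_cos_le1 (x : R) : `|cos x| <= 1.
Proof. by rewrite ler_norml cos_geN1 cos_le1. Qed.

Lemma continuous_scale (y : R) : continuous (fun w : R => w * y).
Proof. by move=> w; apply: cvgM; [exact: cvg_id|exact: cvg_cst]. Qed.

Lemma continuous_cosM (y : R) : continuous (fun w : R => cos (w * y)).
Proof.
move=> w; apply: continuous_comp; last exact: continuous_cos.
exact: continuous_scale.
Qed.

Lemma expR_decay_cvg0 (e : R) : 0 < e -> expR (- e * w) @[w --> +oo] --> (0:R).
Proof.
move=> e0.
have : (fun w : R => expR (- w)) \o (fun w => w * e) @ +oo --> (0:R).
  apply: cvg_comp; last exact: cvgr_expR.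
  exact/gt0_cvgMly.
by apply: cvg_trans; apply: near_eq_cvg; apply: nearW => w /=; congr expR; ring.
Qed.

(** The constant $1$ keeps the integrand nonnegative, so that the improper
    integral is a monotone limit. *)
Lemma laplace_one_plus_cos (e y c : R) : 0 < e -> `|c| <= 1 ->
  (\int[mu]_(w in `[0%R, +oo[) (expR (- e * w) * (1 + c * cos (w * y)))%:E
    = (e^-1 + c * (e / (e ^+ 2 + y ^+ 2)))%:E)%E.
Proof.
move=> e0 c1.
have q0 : e ^+ 2 + y ^+ 2 != 0.
  by rewrite gt_eqF// ltr_wpDr ?sqr_ge0// exprn_gt0.
pose F (w : R) : R := expR (- e * w) *
  (- e^-1 + c / (e ^+ 2 + y ^+ 2) * (y * sin (w * y) - e * cos (w * y))).
have dF (w : R) : is_derive w 1 F (expR (- e * w) * (1 + c * cos (w * y))).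
  rewrite /F; apply: is_derive_eq.
  rewrite /GRing.scale /=.
  by field; rewrite q0 gt_eqF.
have ce : continuous (fun w : R => expR (- e * w) * (1 + c * cos (w * y))).
  move=> w; apply: cvgM.
    apply: continuous_comp; last exact: continuous_expR.
    by apply: cvgM; [exact: cvg_cst|exact: cvg_id].
  apply: cvgD; first exact: cvg_cst.
  apply: cvgM; first exact: cvg_cst.
  exact: continuous_cosM.
rewrite (@ge0_continuous_FTC2y _ _ F 0 0).
- congr EFin; rewrite /F mulr0 expR0 mul0r sin0 cos0 sub0r.
  by field; rewrite q0 gt_eqF.
- move=> w _; rewrite mulr_ge0 ?expR_ge0//.
  have : `|c * cos (w * y)| <= 1.
    by rewrite normrM mulr_ile1// ler_norml cos_geN1 cos_le1.
  by rewrite ler_norml => /andP[+ _]; rewrite -lerBlDl sub0r.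
- exact: continuous_subspaceT.
- apply/norm_cvg0P.
  pose M := e^-1 + `|c / (e ^+ 2 + y ^+ 2)| * (`|y| + e).
  have cM : expR (- e * w) * M @[w --> +oo] --> (0:R).
    rewrite -[X in _ --> X](mul0r M); apply: cvgM; last exact: cvg_cst.
    exact: expR_decay_cvg0.
  apply: (squeeze_cvgr _ (cvg_cst 0) cM); apply: nearW => w.
  rewrite normr_ge0 /F normrM ger0_norm ?expR_ge0// ler_wpM2l ?expR_ge0//.
  rewrite (le_trans (ler_normD _ _))// lerD//.
    by rewrite normrN ger0_norm// invr_ge0 ltW.
  rewrite normrM ler_wpM2l//.
  rewrite (le_trans (ler_normB _ _))// !normrM lerD//.
    by rewrite ler_piMr// normr_sin_le1.
  by rewrite gtr0_norm// ler_piMr ?normr_cos_le1// ltW.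
- by move=> w _; exact: ex_derive.
- apply: cvg_at_right_filter; apply: differentiable_continuous.
  by apply/derivable1_diffP; exact: ex_derive.
- by move=> w _; rewrite derive1E; exact: derive_val.
Qed.

Lemma integrable_ge0_Rintegral (D : set R) (f : R -> R) (l : R) :
  measurable D -> measurable_fun D f -> (forall x, D x -> 0 <= f x) ->
  (\int[mu]_(x in D) (f x)%:E = l%:E)%E ->
  mu.-integrable D (EFin \o f) /\ \int[mu]_(x in D) f x = l.
Proof.
move=> mD mf f0 fl; split; last by rewrite /Rintegral fl.
apply/integrableP; split; first exact/measurable_EFinP.
rewrite [ltLHS](_ : _ = l%:E) ?ltry// -fl.
by apply: eq_integral => x /[!inE] Dx /=; rewrite ger0_norm ?f0.
Qed.

Lemma continuous_expRM (e : R) : continuous (fun w : R => expR (- e * w)).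
Proof.
move=> w; apply: continuous_comp; last exact: continuous_expR.
by apply: cvgM; [exact: cvg_cst|exact: cvg_id].
Qed.

Lemma integrable_expRM (e : R) : 0 < e ->
  mu.-integrable `[0%R, +oo[ (EFin \o (fun w => expR (- e * w))).
Proof.
move=> e0; have h0 : `|0 : R| <= 1 by rewrite normr0.
have := laplace_one_plus_cos 0 e0 h0.
under eq_integral do rewrite mul0r addr0 mulr1.
rewrite mul0r addr0 => /integrable_ge0_Rintegral[]//.
by apply: measurable_funTS; apply: continuous_measurable_fun; exact: continuous_expRM.
Qed.

Lemma laplace_cos (e y : R) : 0 < e ->
  \int[mu]_(w in `[0%R, +oo[) (expR (- e * w) * cos (w * y)) =
  e / (e ^+ 2 + y ^+ 2).
Proof.
move=> e0.
have h1 : `|1 : R| <= 1 by rewrite normr1.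
have h0 : `|0 : R| <= 1 by rewrite normr0.
have := laplace_one_plus_cos y e0 h1.
move=> /integrable_ge0_Rintegral[]//.
  apply: measurable_funTS; apply: continuous_measurable_fun => w.
  apply: cvgM; first exact: continuous_expRM.
  apply: cvgD; first exact: cvg_cst.
  by apply: cvgM; [exact: cvg_cst|exact: continuous_cosM].
move=> i1 E1.
have := laplace_one_plus_cos 0 e0 h0.
under eq_integral do rewrite mul0r addr0 mulr1.
rewrite mul0r addr0 => /(congr1 fine); rewrite -/(Rintegral _ _ _) /= => E0.
transitivity (\int[mu]_(w in `[0%R, +oo[)
  (expR (- e * w) * (1 + 1 * cos (w * y)) - expR (- e * w))).
  by apply: eq_Rintegral => w _; ring.
rewrite RintegralB//; last exact: integrable_expRM.
by rewrite E1 E0; ring.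
Qed.
End Fourier.

(** * One-sided Fourier inversion *)

Section Approx.
Context {R : realType}.
Notation mu := (@lebesgue_measure R).

Lemma Rintegral_indic_itv (e : R) : 0 < e ->
  mu.-integrable setT (EFin \o \1_(`[- e, e] : set R)) /\
  \int[mu]_x (\1_(`[- e, e] : set R) x) = 2 * e.
Proof.
move=> e0; apply: integrable_ge0_Rintegral => //.
rewrite integral_indic// setIT /= lebesgue_measure_itv/= lte_fin gtrN// -EFinB.
by congr EFin; ring.
Qed.

Lemma cauchy_kernel_ge0 (e y : R) : 0 < e -> 0 <= e / (e ^+ 2 + y ^+ 2).
Proof. by move=> e0; rewrite divr_ge0 ?(ltW e0)// addr_ge0// sqr_ge0. Qed.

Lemma cauchy_kernel_le (e y : R) : 0 < e -> e / (e ^+ 2 + y ^+ 2) <= e^-1.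
Proof.
move=> e0; rewrite ler_pdivrMr; last by rewrite ltr_wpDr ?sqr_ge0// exprn_gt0.
by rewrite mulrDr expr2 mulKf ?gt_eqF// lerDl mulr_ge0 ?sqr_ge0// invr_ge0 (ltW e0).
Qed.

Lemma integrable_cauchy_kernel (f : R -> R) (e : R) : 0 < e ->
  continuous f -> mu.-integrable setT (EFin \o f) ->
  mu.-integrable setT (EFin \o (fun y => f y * (e / (e ^+ 2 + y ^+ 2)))).
Proof.
move=> e0 cf fi.
have q0 (y : R) : e ^+ 2 + y ^+ 2 != 0.
  by rewrite gt_eqF// ltr_wpDr ?sqr_ge0// exprn_gt0.
have := integrableZl measurableT e^-1 fi; apply: le_integrable => //.
- apply/measurable_EFinP; apply: continuous_measurable_fun => y.
  apply: cvgM; first exact: cf.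
  apply: cvgM; first exact: cvg_cst.
  apply: cvgV => //; apply: cvgD; first exact: cvg_cst.
  exact: exprn_continuous.
- move=> y _ /=; rewrite lee_fin normrM mulrC [X in _ <= X]normrM ler_wpM2r//.
  rewrite [X in _ <= X]ger0_norm ?invr_ge0 ?(ltW e0)//.
  by rewrite ger0_norm ?cauchy_kernel_le// cauchy_kernel_ge0.
Qed.

(** If $f(0) > B$ then $f \ge c > B$ on some $[-\eta,\eta]$. The kernel is at
    least $1/(2e)$ on $[-e,e]$, which gives a contribution at least $c$, the
    integrand is nonnegative on the rest of $[-\eta,\eta]$, and the kernel is at
    most $e/\eta^2$ outside $[-\eta,\eta]$, where the integrability of $f$ makes
    the loss small. *)
Lemma value_le_cauchy_averages (f : R -> R) (B : R) :
  continuous f -> mu.-integrable setT (EFin \o f) -> 0 <= B ->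
  (forall e, 0 < e -> \int[mu]_y (f y * (e / (e ^+ 2 + y ^+ 2))) <= B) ->
  f 0 <= B.
Proof.
move=> cf fi B0 fB; rewrite leNgt; apply/negP => Bf.
pose c := (f 0 + B) / 2.
have cB : B < c by rewrite /c; lra.
have cf0 : c < f 0 by rewrite /c; lra.
have [eta /= eta0 hc] : exists2 eta : R, 0 < eta & forall y, `|y| <= eta -> c <= f y.
  have /nbhs_ballP[r /= r0 hr] : \forall y \near (0:R), c < f y.
    exact: (cvgr_gt _ (cf 0) _ cf0).
  exists (r / 2); first by rewrite divr_gt0.
  move=> y yr; apply: ltW; apply: hr; rewrite /ball /= sub0r normrN.
  by rewrite (le_lt_trans yr)// ltr_pdivrMr// ltr_pMr// ltr1n.
pose N := \int[mu]_y `|f y|.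
have N0 : 0 <= N by apply: Rintegral_ge0.
(* Below this bound the loss $e\|f\|_1/\eta^2$ is less than $c - B$. *)
pose e := Num.min eta (eta ^+ 2 * (c - B) / (2 * (N + 1))).
have e0 : 0 < e.
  by rewrite lt_min eta0/= divr_gt0// ?mulr_gt0 ?exprn_gt0 ?subr_gt0// ltr_wpDl.
have [i1 E1] := Rintegral_indic_itv e0.
have ni := integrable_norm fi.
have li : mu.-integrable setT (EFin \o (fun y => c / (2 * e) * \1_(`[- e, e] : set R) y)).
  have := integrableZl measurableT (c / (2 * e)) i1.
  by apply: eq_integrable => // y _.
have ri : mu.-integrable setT (EFin \o (fun y => e / eta ^+ 2 * `|f y|)).
  have := integrableZl measurableT (e / eta ^+ 2) ni.
  by apply: eq_integrable => // y _.
have := fB e e0; apply/negP; rewrite -ltNge.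
have : \int[mu]_y (c / (2 * e) * \1_(`[- e, e] : set R) y - e / eta ^+ 2 * `|f y|)
  <= \int[mu]_y (f y * (e / (e ^+ 2 + y ^+ 2))).
  apply: le_Rintegral => //.
  - have := integrableB measurableT li ri.
    by apply: eq_integrable => // y _.
  - exact: integrable_cauchy_kernel.
  - move=> y _.
    have k0 := cauchy_kernel_ge0 y e0.
    have e2 : 0 <= e / eta ^+ 2 by rewrite divr_ge0 ?sqr_ge0// (ltW e0).
    have ef : 0 <= e / eta ^+ 2 * `|f y| by rewrite mulr_ge0.
    have [ye|ye] := leP `|y| e.
      have fy : c <= f y by apply: hc; rewrite (le_trans ye)// /e ge_min lexx.
      rewrite lerBlDr (le_trans _ (_ : f y * (e / (e ^+ 2 + y ^+ 2)) <= _)) ?lerDl//.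
      rewrite indicE mem_set ?mulr1; last by rewrite /= in_itv/= -ler_norml.
      apply: ler_pM => //; [lra|by rewrite invr_ge0 mulr_ge0// (ltW e0)|].
      rewrite ler_pdivlMr; last by rewrite ltr_wpDr ?sqr_ge0// exprn_gt0.
      rewrite ler_pdivrMl ?mulr_gt0//.
      have : y ^+ 2 <= e ^+ 2 by rewrite -real_normK ?num_real// lerXn2r// nnegrE// ltW.
      lra.
    rewrite indicE memNset ?mulr0 ?sub0r; last first.
      by rewrite /= in_itv/= -ler_norml; apply/negP; rewrite -ltNge.
    have [yeta|yeta] := leP `|y| eta.
      rewrite (@le_trans _ _ 0)// ?oppr_le0// mulr_ge0//.
      by have := hc _ yeta; lra.
    apply: (@le_trans _ _ (- (e / (e ^+ 2 + y ^+ 2) * `|f y|))).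
      rewrite lerN2 ler_wpM2r// ler_wpM2l ?(ltW e0)// lef_pV2 ?posrE ?exprn_gt0//; last first.
        by rewrite ltr_wpDr ?sqr_ge0// exprn_gt0.
      rewrite ler_wpDl ?sqr_ge0// -[y ^+ 2]real_normK ?num_real//.
      by rewrite lerXn2r// ?nnegrE// ltW.
    rewrite mulrC -mulNr ler_wpM2r//.
    by rewrite lerNl -normrN ler_norm.
apply: lt_le_trans.
rewrite RintegralB// !RintegralZl// E1 -/N divfK ?mulf_neq0 ?gt_eqF//.
suff : e / eta ^+ 2 * N < c - B by lra.
rewrite mulrAC ltr_pdivrMr ?exprn_gt0//.
have : e <= eta ^+ 2 * (c - B) / (2 * (N + 1)) by rewrite /e ge_min lexx orbT.
rewrite ler_pdivlMr ?mulr_gt0// ?ltr_wpDl//.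
have : 0 < (c - B) * eta ^+ 2 by rewrite mulr_gt0 ?subr_gt0// exprn_gt0.
move: e0 N0; nra.
Qed.
End Approx.

Section Inversion.
Context {R : realType}.
Notation mu := (@lebesgue_measure R).

Lemma continuous_cosMl (w : R) : continuous (fun y : R => cos (w * y)).
Proof.
move=> y; apply: continuous_comp; last exact: continuous_cos.
by apply: cvgM; [exact: cvg_cst|exact: cvg_id].
Qed.

Lemma integrable_cos_transform (f : R -> R) (w : R) : continuous f ->
  mu.-integrable setT (EFin \o f) ->
  mu.-integrable setT (EFin \o (fun y => f y * cos (w * y))).
Proof.
move=> cf fi; apply: le_integrable (fi) => //.
  apply/measurable_EFinP; apply: continuous_measurable_fun => y.
  by apply: cvgM; [exact: cf|exact: continuous_cosMl].
by move=> y _ /=; rewrite lee_fin normrM ler_piMr// normr_cos_le1.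
Qed.

Lemma EFin_Rintegral (D : set R) (f : R -> R) : measurable D ->
  mu.-integrable D (EFin \o f) ->
  (\int[mu]_(x in D) (f x)%:E)%E = (\int[mu]_(x in D) f x)%:E.
Proof. by move=> mD fi; rewrite /Rintegral fineK//; exact: integrable_fin_num. Qed.

(** With damping $e^{-e\omega}$ the inversion integral converges absolutely in
    both variables; Fubini's theorem identifies it with the average of $f$
    against the Laplace transform of the cosine, and the damping only lowers the
    upper bound $h \ge 0$. *)
Lemma fourier_inversion_le (f h : R -> R) :
  continuous f -> mu.-integrable setT (EFin \o f) ->
  mu.-integrable `[0%R, +oo[ (EFin \o h) ->
  (forall w, 0 <= w -> 0 <= h w) ->
  (forall w, 0 <= w -> \int[mu]_y (f y * cos (w * y)) <= h w) ->
  f 0 <= \int[mu]_(w in `[0%R, +oo[) h w.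
Proof.
move=> cf fi hi h0 fh; apply: value_le_cauchy_averages => //.
  by apply: Rintegral_ge0 => w /=; rewrite in_itv/= andbT; exact: h0.
move=> e e0.
pose D : set (measurableTypeR R) := `[0%R, +oo[%classic.
have mD : measurable D by exact: measurable_itv.
pose g (w : R) : R := expR (- e * w) * \1_D w.
have gE : EFin \o g = (EFin \o (fun w => expR (- e * w))) \_ D.
  by rewrite restrict_EFin patch_indic.
have gi : mu.-integrable setT (EFin \o g).
  by rewrite gE; exact: (iffLR (integrable_mkcond _ mD) (integrable_expRM e0)).
have g0 w : 0 <= g w by rewrite mulr_ge0 ?expR_ge0.
have mg : measurable_fun setT g by case/integrableP : gi => /measurable_EFinP.
pose phi (p : R * R) : R := f p.2 * (g p.1 * cos (p.1 * p.2)).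
have mphi : measurable_fun setT (EFin \o phi).
  apply/measurable_EFinP; apply: measurable_funM.
    by apply: measurableT_comp; first exact: continuous_measurable_fun.
  apply: measurable_funM; first exact: measurableT_comp.
  apply: measurableT_comp.
    by apply: continuous_measurable_fun; exact: continuous_cos.
  exact: measurable_funM.
have iN := integrable_norm fi.
have phi_w w : mu.-integrable setT (EFin \o (fun y => phi (w, y))).
  have := integrableZl measurableT (g w) (integrable_cos_transform w cf fi).
  apply: eq_integrable => // y _ /=.
  by rewrite -EFinM; congr EFin; rewrite /phi/=; ring.
have Nphi_w w y : `|phi (w, y)| <= g w * `|f y|.
  rewrite /phi/= mulrCA normrM ger0_norm// ler_wpM2l// normrM ler_piMr//.
  exact: normr_cos_le1.
have E3 w : \int[mu]_y phi (w, y) = g w * \int[mu]_y (f y * cos (w * y)).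
  rewrite -RintegralZl//; last exact: integrable_cos_transform.
  by apply: eq_Rintegral => y _; rewrite /phi/=; ring.
have phii : (mu \x mu)%E.-integrable setT (EFin \o phi).
  apply/integrable12ltyP => //.
  apply: (@le_lt_trans _ _ (\int[mu]_w (g w * \int[mu]_y `|f y|)%:E)%E).
    apply: ge0_le_integral => //=.
    - by move=> w _; exact: integral_ge0.
    - apply: (measurable_fun_fubini_tonelli_F (m2 := mu) (fun p => `|phi p|%:E)) => //.
      by apply/measurable_EFinP; apply: measurableT_comp => //; exact/measurable_EFinP.
    - by apply/measurable_EFinP; exact: measurable_funM.
    move=> w _.
    rewrite EFin_Rintegral//; last exact: (integrable_norm (phi_w w)).
    rewrite lee_fin -RintegralZl//; apply: le_Rintegral => //.
    - exact: (integrable_norm (phi_w w)).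
    - exact: (integrableZl measurableT (g w) iN).
  by apply: (integrable_lty measurableT); exact: (integrableZr measurableT _ gi).
have gcos y : mu.-integrable setT (EFin \o (fun w => g w * cos (w * y))).
  apply: le_integrable gi => //.
    apply/measurable_EFinP; apply: measurable_funM => //.
    by apply: continuous_measurable_fun; exact: continuous_cosM.
  by move=> w _ /=; rewrite lee_fin normrM ler_piMr// normr_cos_le1.
have phi_y y : mu.-integrable setT (EFin \o (fun w => phi (w, y))).
  exact: (integrableZl measurableT (f y) (gcos y)).
have E1 : \int[mu]_y (f y * (e / (e ^+ 2 + y ^+ 2))) = \int[mu]_y \int[mu]_w phi (w, y).
  apply: eq_Rintegral => y _.
  have gcE : (fun w => g w * cos (w * y)) = (fun w => expR (- e * w) * cos (w * y)) \_ D.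
    by rewrite patch_indic; apply/funext => w /=; rewrite /g; ring.
  by rewrite /phi /= RintegralZl// gcE -Rintegral_mkcond laplace_cos.
have E2 : \int[mu]_y \int[mu]_w phi (w, y) = \int[mu]_w \int[mu]_y phi (w, y).
  rewrite /Rintegral; congr fine.
  under eq_integral do rewrite -/(Rintegral _ _ _) -EFin_Rintegral//.
  under [RHS]eq_integral do rewrite -/(Rintegral _ _ _) -EFin_Rintegral//.
  by rewrite [RHS](Fubini phii).
have hD : mu.-integrable setT (EFin \o (h \_ D)).
  by rewrite -restrict_EFin; exact: (iffLR (integrable_mkcond _ mD) hi).
rewrite E1 E2 [leRHS]Rintegral_mkcond.
apply: le_Rintegral => //.
  have := integrable_fubini_F phii; apply: eq_integrable => // w _.
  by rewrite /fubini_F /= EFin_Rintegral.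
move=> w _; rewrite E3 patch_indic /g /=.
have [Dw|Dw] := boolP (w \in D); last first.
  by rewrite indicE (negbTE Dw) !mulr0 mul0r.
rewrite indicE Dw !mulr1.
have w0 : 0 <= w by move: Dw; rewrite inE /D/= in_itv/= andbT.
have e1 : expR (- e * w) <= 1.
  by rewrite -expR0 ler_expR mulNr oppr_le0 mulr_ge0// ltW.
apply: (le_trans (ler_wpM2l (expR_ge0 _) (fh w w0))).
by rewrite ler_piMl// h0.
Qed.
End Inversion.

(** * Quadratic forms of a covariance function *)

Section Spectral.
Context {R : realType}.
Notation mu := (@lebesgue_measure R).

Lemma integrable_EFin_sum (I : finType) (f : I -> R -> R) :
  (forall i, mu.-integrable setT (EFin \o f i)) ->
  mu.-integrable setT (EFin \o (fun y => \sum_i f i y)).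
Proof.
move=> fi; rewrite (_ : _ \o _ = (fun y => \sum_i (EFin \o f i) y)%E).
  exact: integrable_sum.
by apply/funext => y /=; rewrite sumEFin.
Qed.

Lemma Rintegral_sum (I : finType) (f : I -> R -> R) :
  (forall i, mu.-integrable setT (EFin \o f i)) ->
  \int[mu]_y (\sum_i f i y) = \sum_i \int[mu]_y f i y.
Proof.
move=> fi; apply: EFin_inj; rewrite -sumEFin.
under eq_bigr do rewrite -EFin_Rintegral//.
rewrite -EFin_Rintegral//; last exact: integrable_EFin_sum.
rewrite -integral_sum//.
by apply: eq_integral => y _; rewrite sumEFin.
Qed.

Lemma integrable_sin_transform (f : R -> R) (w : R) : continuous f ->
  mu.-integrable setT (EFin \o f) ->
  mu.-integrable setT (EFin \o (fun y => f y * sin (w * y))).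
Proof.
move=> cf fi; apply: le_integrable (fi) => //.
  apply/measurable_EFinP; apply: continuous_measurable_fun => y.
  apply: cvgM; first exact: cf.
  apply: continuous_comp; last exact: continuous_sin.
  by apply: cvgM; [exact: cvg_cst|exact: cvg_id].
by move=> y _ /=; rewrite lee_fin normrM ler_piMr// normr_sin_le1.
Qed.

Lemma cos_transform_shift (f : R -> R) (w u : R) : continuous f ->
  mu.-integrable setT (EFin \o f) ->
  \int[mu]_y (f (y + u) * cos (w * y)) =
  cos (w * u) * \int[mu]_y (f y * cos (w * y)) +
  sin (w * u) * \int[mu]_y (f y * sin (w * y)).
Proof.
move=> cf fi.
have ic := integrable_cos_transform w cf fi.
have is_ := integrable_sin_transform w cf fi.
have gE : (fun y => f y * cos (w * (y - u))) =
    (fun y => cos (w * u) * (f y * cos (w * y)) + sin (w * u) * (f y * sin (w * y))).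
  by apply/funext => y; rewrite mulrBr cosB; ring.
have icu := integrableZl measurableT (cos (w * u)) ic.
have isu := integrableZl measurableT (sin (w * u)) is_.
rewrite -!RintegralZl// -RintegralD//.
transitivity (\int[mu]_y (f y * cos (w * (y - u)))); last by rewrite gE.
rewrite -[RHS](Rintegral_shift u).
- by apply: eq_Rintegral => y _; rewrite addrK.
- move=> y; apply: cvgM; first exact: cf.
  apply: (@continuous_comp _ _ _ (fun y => y - u) (fun y => cos (w * y))).
    by apply: cvgB; [exact: cvg_id|exact: cvg_cst].
  exact: continuous_cosMl.
- rewrite gE; have := integrableD measurableT icu isu.
  by apply: eq_integrable.
Qed.

(** The double sum is the value at $0$ of
    $y \mapsto \sum_{i,j} a_i a_j K(y+s_i-s_j)$, whose cosine transform is that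
    of $K$ times the squared modulus of $\sum_i a_i e^{\mathrm i w s_i}$. *)
Lemma quadratic_form_spectral_le (I : finType) (s a : I -> R) (K h : R -> R) :
  continuous K -> mu.-integrable setT (EFin \o K) ->
  mu.-integrable `[0%R, +oo[ (EFin \o h) ->
  (forall w, 0 <= w -> 0 <= h w) ->
  (forall w, 0 <= w ->
    (\sum_i \sum_j a i * a j * cos (w * (s i - s j))) *
    \int[mu]_y (K y * cos (w * y)) <= h w) ->
  \sum_i \sum_j a i * a j * K (s i - s j) <= \int[mu]_(w in `[0%R, +oo[) h w.
Proof.
move=> cK Ki hi h0 Kh.
pose D (p : I * I) (y : R) : R := a p.1 * a p.2 * K (y + (s p.1 - s p.2)).
have cD p : continuous (D p).
  by move=> y; apply: cvgM; [exact: cvg_cst|exact: continuous_shift].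
have Di p : mu.-integrable setT (EFin \o D p).
  exact: (integrableZl measurableT (a p.1 * a p.2) (integrable_shift (s p.1 - s p.2) cK Ki)).
pose f (y : R) : R := \sum_p D p y.
have cf : continuous f.
  by apply: continuous_big => [|p _]; [exact: add_continuous|exact: cD].
have fi : mu.-integrable setT (EFin \o f) by exact: integrable_EFin_sum.
have -> : \sum_i \sum_j a i * a j * K (s i - s j) = f 0.
  by rewrite pair_bigA; apply: eq_bigr => p _; rewrite /D add0r.
apply: fourier_inversion_le => // w w0; apply: le_trans (Kh w w0).
have -> : \int[mu]_y (f y * cos (w * y)) = \sum_p \int[mu]_y (D p y * cos (w * y)).
  rewrite -Rintegral_sum; last by move=> p; exact: integrable_cos_transform.
  by apply: eq_Rintegral => y _; rewrite mulr_suml.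
set C := \int[mu]_y (K y * cos (w * y)).
pose S := \int[mu]_y (K y * sin (w * y)).
have DE p : \int[mu]_y (D p y * cos (w * y)) =
    a p.1 * a p.2 * cos (w * (s p.1 - s p.2)) * C + a p.1 * a p.2 * sin (w * (s p.1 - s p.2)) * S.
  under eq_Rintegral do rewrite /D -mulrA.
  rewrite RintegralZl//.
    by rewrite cos_transform_shift// -/C -/S; ring.
  apply: integrable_cos_transform; first exact: continuous_shift.
  exact: integrable_shift.
under eq_bigr do rewrite DE.
rewrite big_split/= -!mulr_suml pair_bigA/= [X in _ + X * _](_ : _ = 0) ?mul0r ?addr0//.
(* Exchanging $i$ and $j$ changes the sign of the sine terms. *)
rewrite -(pair_bigA _ (fun i j => a i * a j * sin (w * (s i - s j))))/=.
set X := \sum_i _.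
have : X = - X.
  rewrite {1}/X exchange_big/= -sumrN; apply: eq_bigr => i _.
  rewrite -sumrN; apply: eq_bigr => j _.
  by rewrite -opprB mulrN sinN; ring.
by move=> XN; apply/eqP; move/eqP: XN; rewrite -addr_eq0 -mulr2n mulrn_eq0.
Qed.
End Spectral.

(** * The spectrum of iterated differences *)

Section PowerTail.
Context {R : realType}.
Notation mu := (@lebesgue_measure R).

Lemma powRN_cvg0 (p : R) : 0 < p -> w `^ (- p) @[w --> +oo] --> (0:R).
Proof.
move=> p0.
have py : w `^ p @[w --> +oo] --> +oo.
  apply/cvgryPge => A; near=> w.
  have w1 : (`|A| `^ p^-1) <= w by near: w; exact: nbhs_pinfty_ge.
  rewrite (le_trans (ler_norm A))// -[leLHS]powRr1// -(mulVf (lt0r_neq0 p0)) powRrM.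
  by apply: ge0_ler_powR; rewrite ?nnegrE ?powR_ge0// ?(le_trans _ w1)// ltW.
have -> : (fun w : R => w `^ (- p)) = (fun w => (w `^ p)^-1).
  by apply/funext => w; rewrite powRN.
apply/gtr0_cvgV0 => //.
by near=> w; apply: powR_gt0; near: w; exact: nbhs_pinfty_gt.
Unshelve. all: by end_near. Qed.

(** For $a = 2n$ and $p = 2\nu$ this is the majorant of the filtered spectral
    density: flat below the cut-off frequency $a$, a power beyond it. *)
Lemma integral_truncated_power (a p : R) : 0 < a -> 0 < p ->
  let h := fun w : R => Num.max w a `^ (- (p + 1)) in
  mu.-integrable `[0%R, +oo[ (EFin \o h) /\
  \int[mu]_(w in `[0%R, +oo[) h w = a `^ (- p) * (1 + p^-1).
Proof.
move=> a0 p0 h.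
have h0 w : 0 <= h w by exact: powR_ge0.
have mx0 w : 0 < Num.max w a by rewrite lt_max a0 orbT.
have cp (w : R) : 0 < w -> {for w, continuous (fun w : R => w `^ (- (p + 1)))}.
  move=> w0; apply: differentiable_continuous; apply/derivable1_diffP.
  by apply: ex_derive; exact: is_derive1_powR.
have ch : continuous h.
  move=> w; apply: (@continuous_comp _ _ _ (fun w => Num.max w a) (fun w => w `^ (- (p + 1)))).
    by apply: continuous_max; [exact: cvg_id|exact: cvg_cst].
  exact: cp.
have mh (D : set (measurableTypeR R)) : measurable_fun D h.
  by apply: measurable_funTS; exact: continuous_measurable_fun.
apply: integrable_ge0_Rintegral => //; first exact: mh.
have -> : `[0%R, +oo[%classic = `[0%R, a[%classic `|` `[a, +oo[%classic :> set (measurableTypeR R).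
  by rewrite -itv_bndbnd_setU// bnd_simp// ltW.
rewrite ge0_integral_setU//=; last 3 first.
- by apply/measurable_EFinP; exact: mh.
- by move=> w _; rewrite lee_fin.
- rewrite disj_set2E; apply/eqP; rewrite -subset0 => x []/=; rewrite !in_itv/= andbT.
  by move=> /andP[_ xa]; rewrite leNgt xa.
have -> : (\int[mu]_(w in `[0%R, a[) (h w)%:E = (a `^ (- p))%:E)%E.
  under eq_integral => w.
    rewrite inE/= in_itv/= => /andP[_ wa].
    rewrite /h max_r ?(ltW wa)//; over.
  rewrite integral_cst//= lebesgue_measure_itv/= lte_fin a0 oppr0 adde0 -EFinM.
  congr EFin; rewrite -{2}(powRr1 (ltW a0)) -powRD; last by rewrite (gt_eqF a0) implybT.
  by congr powR; ring.
have -> : (\int[mu]_(w in `[a, +oo[) (h w)%:E = (a `^ (- p) / p)%:E)%E.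
  pose F (w : R) : R := - p^-1 * w `^ (- p).
  have dF (w : R) : 0 < w -> is_derive w 1 F (w `^ (- (p + 1))).
    move=> w0; have d1 := is_derive1_powR (- p) w0.
    rewrite /F; apply: is_derive_eq.
    rewrite /GRing.scale/= (_ : - (p + 1) = - p - 1); last ring.
    by field; rewrite gt_eqF.
  transitivity (\int[mu]_(w in `[a, +oo[) (w `^ (- (p + 1)))%:E)%E.
    apply: eq_integral => w; rewrite inE/= in_itv/= andbT => aw.
    by rewrite /h max_l.
  rewrite (@ge0_continuous_FTC2y _ _ F a 0).
  - by rewrite sub0e -EFinN; congr EFin; rewrite /F; ring.
  - by move=> w _; exact: powR_ge0.
  - apply: continuous_in_subspaceT => w; rewrite inE/= in_itv/= andbT => aw.
    by apply: cp; exact: lt_le_trans aw.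
  - rewrite -[X in _ --> X](mulr0 (- p^-1)); apply: cvgM; first exact: cvg_cst.
    exact: powRN_cvg0.
  - by move=> w aw; apply: ex_derive; apply: dF; exact: lt_trans aw.
  - apply: cvg_at_right_filter; apply: differentiable_continuous.
    by apply/derivable1_diffP; apply: ex_derive; exact: dF.
  - move=> w; rewrite in_itv/= andbT => aw; rewrite derive1E.
    by apply: derive_val; apply: dF; exact: lt_trans aw.
by rewrite -EFinD; congr EFin; ring.
Qed.
End PowerTail.


Section FiniteDifference.
Context {R : realType}.

Lemma sin_le_id (x : R) : 0 <= x -> `|sin x| <= x.
Proof.
move=> x0.
have [c _] := @MVT_segment R sin cos 0 x x0 (fun y _ => is_derive_sin y)
  (continuous_subspaceT (@continuous_sin R)).
rewrite sin0 !subr0 => ->.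
by rewrite normrM (ger0_norm x0) ler_piMl// normr_cos_le1.
Qed.

Definition diff_coef (M j : nat) : R := (-1) ^+ j * 'C(M, j)%:R.

(** By Pascal's rule, differences of order $M+1$ are differences of order $M$
    of first differences. *)
Lemma finite_difference_rec (M : nat) (f : nat -> R) :
  \sum_(j < M.+2) diff_coef M.+1 j * f j =
  \sum_(j < M.+1) diff_coef M j * (f j - f j.+1).
Proof.
rewrite big_ord_recl.
under eq_bigr => j _ do rewrite /diff_coef lift0 binS natrD mulrDr mulrDl.
rewrite big_split/= addrA.
under [RHS]eq_bigr => j _ do rewrite mulrBr.
rewrite sumrB; congr (_ + _).
  rewrite big_ord_recr/= bin_small// mulr0 mul0r addr0 [RHS]big_ord_recl.
  by rewrite /diff_coef !bin0; congr (_ + _).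
rewrite -sumrN; apply: eq_bigr => j _; rewrite exprS /diff_coef; ring.
Qed.

Lemma partial_sum_diff_coef (M k : nat) :
  \sum_(j < k.+1) diff_coef M.+1 j = (-1) ^+ k * 'C(M, k)%:R :> R.
Proof.
elim: k => [|k IH]; first by rewrite big_ord1 /diff_coef !bin0.
by rewrite big_ord_recr/= IH /diff_coef binS natrD exprS; ring.
Qed.

Lemma sum_diff_coef (M : nat) : \sum_(j < M.+2) diff_coef M.+1 j = 0 :> R.
Proof. by rewrite partial_sum_diff_coef bin_small// mulr0. Qed.

(** A first difference multiplies the amplitude by $2\sin(\theta/2)$ and moves
    the phase by $(\theta-\pi)/2$: the real form of
    $1-e^{\mathrm i\theta} = 2\sin(\theta/2)\,e^{\mathrm i(\theta-\pi)/2}$. *)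
Lemma finite_difference_cos (M : nat) (phi theta : R) :
  \sum_(j < M.+1) diff_coef M j * cos (phi + j%:R * theta) =
  (2 * sin (theta / 2)) ^+ M * cos (phi + M%:R * ((theta - pi) / 2)).
Proof.
elim: M phi => [|M IH] phi.
  by rewrite big_ord1 /diff_coef bin0 !mul0r !addr0 !expr0 !mul1r.
rewrite (finite_difference_rec M (fun j => cos (phi + j%:R * theta))).
under eq_bigr => j _ do rewrite mulrBr -natr1 mulrDl mul1r addrA addrAC.
rewrite sumrB !IH -mulrBr exprSr -mulrA; congr (_ * _).
rewrite -(natr1 M) (mulrDl M%:R) mul1r.
set u := phi + M%:R * _.
have -> : phi + theta + M%:R * ((theta - pi) / 2) = u + theta / 2 + theta / 2.
  by rewrite /u; field.
have -> : phi + (M%:R * ((theta - pi) / 2) + (theta - pi) / 2) = u + theta / 2 - pi / 2.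
  by rewrite /u; field.
rewrite [in RHS]cosB cos_pihalf sin_pihalf mulr0 add0r mulr1.
set v := u + theta / 2.
have -> : u = v - theta / 2 by rewrite addrK.
by rewrite cosB cosD; ring.
Qed.

(** The squared gain of the filter, that is $|1-e^{\mathrm i\theta}|^{2M}$. *)
Lemma finite_difference_spectrum (M : nat) (theta : R) :
  \sum_(i < M.+1) \sum_(j < M.+1) diff_coef M i * diff_coef M j *
     cos (theta * (i%:R - j%:R)) = (2 * sin (theta / 2)) ^+ (2 * M).
Proof.
pose A := \sum_(j < M.+1) diff_coef M j * cos (j%:R * theta).
pose B := \sum_(j < M.+1) diff_coef M j * sin (j%:R * theta).
transitivity (A ^+ 2 + B ^+ 2).
  rewrite !expr2 !big_distrlr/= -big_split/=; apply: eq_bigr => i _.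
  rewrite -big_split/=; apply: eq_bigr => j _.
  by rewrite [theta * _]mulrC mulrBl cosB; ring.
have -> : A = (2 * sin (theta / 2)) ^+ M * cos (M%:R * ((theta - pi) / 2)).
  have := finite_difference_cos M 0 theta; rewrite add0r => <-.
  by apply: eq_bigr => j _; rewrite add0r.
have -> : B = (2 * sin (theta / 2)) ^+ M * sin (M%:R * ((theta - pi) / 2)).
  have sE (x : R) : sin x = cos (- (pi / 2) + x).
    by rewrite addrC cosB cos_pihalf sin_pihalf mulr0 add0r mulr1.
  have := finite_difference_cos M (- (pi / 2)) theta; rewrite -sE => <-.
  by apply: eq_bigr => j _; rewrite sE.
by rewrite mulnC exprM; set S := _ ^+ M; rewrite !exprMn -mulrDr cos2Dsin2 mulr1.
Qed.
End FiniteDifference.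

(** * Variance of a high-order difference *)

Section HighFrequency.
Context {R : realType}.
Notation mu := (@lebesgue_measure R).

Lemma spectral_bound_ge0 (K : R -> R) (nu : R) : (0 <= spectral_bound K nu)%E.
Proof.
apply: le_trans (ereal_sup_ubound _); last by exists 0.
by rewrite lee_fin; case: (_ * _)%R => x y; exact: sqrtr_ge0.
Qed.

Lemma cos_transform_le (K : R -> R) (nu w : R) :
  (spectral_bound K nu < +oo)%E ->
  \int[mu]_y (K y * cos (w * y)) <=
  fine (spectral_bound K nu) * (1 + w ^+ 2) `^ (- (nu + 2^-1)).
Proof.
move=> Koo.
have p0 : 0 < (1 + w ^+ 2) `^ (nu + 2^-1).
  by rewrite powR_gt0// ltr_pwDl ?sqr_ge0.
rewrite powRN ler_pdivlMr//.
rewrite -lee_fin fineK; last by rewrite ge0_fin_numE// spectral_bound_ge0.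
apply: le_trans (ereal_sup_ubound _); last by exists w.
rewrite lee_fin Normc.normcM.
rewrite (_ : Normc.normc (real_complex R _) = (1 + w ^+ 2) `^ (nu + 2^-1)); last first.
  by rewrite /= expr0n/= addr0 sqrtr_sqr ger0_norm// ltW.
rewrite ler_wpM2r ?(ltW p0)//.
rewrite /fourier /= (le_trans (ler_norm _))// -sqrtr_sqr.
by rewrite ler_wsqrtr// lerDl sqr_ge0.
Qed.

(** Below the cut-off $2N$ the gain is at most $(\omega/N)^M$, a power high
    enough to compensate the factor $\omega^{-2\nu-1}$ bounding the spectral
    density; above it, the gain is at most $2^M$. *)
Lemma high_pass_le (N nu w : R) (M : nat) : 0 < N -> 0 < nu ->
  nu + 2^-1 <= M%:R -> 0 <= w ->
  (2 * sin (w / N / 2)) ^+ (2 * M) * (1 + w ^+ 2) `^ (- (nu + 2^-1)) <=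
  4 ^+ M * Num.max w (2 * N) `^ (- (2 * nu + 1)).
Proof.
move=> N0 nu0 nuM w0.
have N20 : 0 < 2 * N by rewrite mulr_gt0.
set p := nu + 2^-1.
have pE : 2 * nu + 1 = 2%:R * p by rewrite /p; field.
have p0 : 0 < p by rewrite addr_gt0// invr_gt0.
have Epow (x : R) : 0 <= x -> x `^ (- (2 * nu + 1)) = (x ^+ 2) `^ (- p).
  by move=> x0; rewrite pE -mulrN powRrM powR_mulrn.
rewrite exprM; set S := _ ^+ 2.
have S0 : 0 <= S by exact: sqr_ge0.
have q0 : 0 < 1 + w ^+ 2 by rewrite ltr_pwDl ?sqr_ge0.
have [w2N|w2N] := leP w (2 * N).
  rewrite Epow ?(ltW N20)//.
  set t := w / (2 * N).
  have t0 : 0 <= t by rewrite divr_ge0// ltW.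
  have t1 : t <= 1 by rewrite ler_pdivrMr// mul1r.
  have St : S <= 4 * t ^+ 2.
    rewrite /S exprMn (_ : 2 ^+ 2 = 4 :> R); last by ring.
    have -> : w / N / 2 = t by rewrite /t invfM; ring.
    rewrite ler_wpM2l// -[sin t ^+ 2]real_normK ?num_real//.
    by rewrite lerXn2r// ?nnegrE// sin_le_id.
  apply: (@le_trans _ _ ((4 * t ^+ 2) ^+ M * (1 + w ^+ 2) `^ (- p))).
    by rewrite ler_wpM2r ?powR_ge0// lerXn2r// nnegrE// mulr_ge0// sqr_ge0.
  rewrite exprMn -mulrA ler_wpM2l ?exprn_ge0//.
  have tp : (t ^+ 2) ^+ M <= (t ^+ 2) `^ p.
    have := t0; rewrite le_eqVlt => /orP[/eqP<-|t_gt0].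
      rewrite expr0n/= powR0 ?gt_eqF// expr0n; case: M nuM => //.
      by rewrite -/p leNgt p0.
    rewrite -powR_mulrn ?sqr_ge0//; apply: ger_powR => //.
    by rewrite exprn_gt0//= exprn_ile1.
  apply: (le_trans (ler_wpM2r (powR_ge0 _ _) tp)).
  rewrite /t expr_div_n powRM ?sqr_ge0// ?invr_ge0 ?sqr_ge0//.
  have -> : ((2 * N) ^+ 2)^-1 `^ p = ((2 * N) ^+ 2) `^ (- p).
    by rewrite -powR_inv1 ?sqr_ge0// -powRrM mulN1r.
  rewrite mulrAC ler_piMl ?powR_ge0// powRN ler_pdivrMr ?powR_gt0// mul1r.
  by apply: ge0_ler_powR; rewrite ?nnegrE ?sqr_ge0 ?(ltW p0) ?(ltW q0)// lerDr.
rewrite Epow// ler_pM ?(exprn_ge0 M S0) ?powR_ge0//.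
  rewrite lerXn2r ?nnegrE// /S exprMn (_ : 2 ^+ 2 = 4 :> R); last by ring.
  by rewrite ler_piMr// -[X in X <= _]real_normK ?num_real// exprn_ile1// normr_sin_le1.
have w_gt0 : 0 < w ^+ 2 by rewrite exprn_gt0// (lt_trans N20).
rewrite !powRN lef_pV2 ?posrE ?powR_gt0//.
by apply: ge0_ler_powR; rewrite ?nnegrE ?sqr_ge0 ?(ltW p0) ?(ltW q0)// lerDr.
Qed.

(** Frequencies of order $n$ and above alone matter for a difference of order
    at least $\nu+1/2$ at step $1/n$, hence the size $n^{-2\nu}$. *)
Lemma finite_difference_variance_le (K : R -> R) (nu : R) (n M : nat) :
  continuous K -> mu.-integrable setT (EFin \o K) -> 0 < nu ->
  (spectral_bound K nu < +oo)%E -> (0 < n)%N -> nu + 2^-1 <= M%:R ->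
  \sum_(i < M.+1) \sum_(j < M.+1)
    diff_coef M i * diff_coef M j * K (i%:R / n%:R - j%:R / n%:R) <=
  fine (spectral_bound K nu) * 4 ^+ M *
    ((2 * n%:R) `^ (- (2 * nu)) * (1 + (2 * nu)^-1)).
Proof.
move=> cK Ki nu0 Koo n0 nuM.
have N0 : 0 < n%:R :> R by rewrite ltr0n.
have CK0 : 0 <= fine (spectral_bound K nu) by rewrite fine_ge0// spectral_bound_ge0.
have a0 : 0 < 2 * n%:R :> R by rewrite mulr_gt0.
have p0 : 0 < 2 * nu by rewrite mulr_gt0.
have [hi hE] := integral_truncated_power a0 p0.
rewrite -hE -RintegralZl//.
apply: (@quadratic_form_spectral_le _ _ (fun i : 'I_M.+1 => i%:R / n%:R)
  (fun i : 'I_M.+1 => diff_coef M i)) => //.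
- exact: (integrableZl _ (fine (spectral_bound K nu) * 4 ^+ M) hi).
- by move=> w w0; rewrite mulr_ge0 ?powR_ge0// mulr_ge0// exprn_ge0.
move=> w w0.
have -> : \sum_(i < M.+1) \sum_(j < M.+1) diff_coef M i * diff_coef M j *
    cos (w * (i%:R / n%:R - j%:R / n%:R)) = (2 * sin (w / n%:R / 2)) ^+ (2 * M).
  rewrite -finite_difference_spectrum; apply: eq_bigr => i _; apply: eq_bigr => j _.
  by congr (_ * cos _); ring.
have W0 : 0 <= (2 * sin (w / n%:R / 2)) ^+ (2 * M) by rewrite exprM exprn_ge0// sqr_ge0.
rewrite (le_trans (ler_wpM2l W0 (cos_transform_le w Koo)))// mulrCA -[leRHS]mulrA.
by rewrite ler_wpM2l// high_pass_le.
Qed.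
End HighFrequency.

(** * The information carried by a jump *)

Section Information.
Context {R : realType}.

Definition quad (n : nat) (S : 'M[R]_n) (x : 'cV[R]_n) : R := (x^T *m S *m x) 0 0.

Lemma quadE (n : nat) (S : 'M[R]_n) (x : 'cV[R]_n) :
  quad S x = \sum_i \sum_j x i 0 * x j 0 * S i j.
Proof.
rewrite /quad mxE exchange_big/=; apply: eq_bigr => j _.
by rewrite mxE mulr_suml; apply: eq_bigr => i _; rewrite mxE; ring.
Qed.

(** The Cauchy-Schwarz inequality of the form $S$ for $v$ and $S^{-1}z$: the form
    is nonnegative at the residual of the $S$-projection of $v$ on $S^{-1}z$. *)
Lemma dot_sqr_le_quad (n : nat) (S : 'M[R]_n) (v z : 'cV[R]_n) :
  S^T = S -> S \in unitmx -> (forall x, 0 <= quad S x) -> 0 < quad (invmx S) z ->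
  ((v^T *m z) 0 0) ^+ 2 <= quad S v * quad (invmx S) z.
Proof.
move=> Ssym Su Spos q0.
set q := quad (invmx S) z in q0 *; set c := (v^T *m z) 0 0.
pose w := invmx S *m z.
have Sw : S *m w = z by rewrite /w mulmxA mulmxV// mul1mx.
have wS : w^T *m S = z^T by rewrite -{1}Ssym -trmx_mul Sw.
have vz : (z^T *m v) 0 0 = c.
  by rewrite -[z^T *m v]trmxK trmx_mul trmxK mxE.
have zw : (z^T *m w) 0 0 = q by rewrite /q /quad mulmxA.
have := Spos (v - (c / q) *: w).
have -> : quad S (v - (c / q) *: w) = quad S v - c ^+ 2 / q.
  have -> : quad S (v - (c / q) *: w) = (((v^T - (c / q) *: w^T) *m S) *m (v - (c / q) *: w)) 0 0.
    by rewrite /quad; congr ((_ *m _ *m _) 0 0); apply/matrixP => i j; rewrite !mxE.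
  rewrite !(mulmxBl, mulmxBr) -!(scalemxAl, scalemxAr) wS -!mulmxA Sw.
  have mxB (A B : 'M[R]_1) : (A - B) 0 0 = A 0 0 - B 0 0 by rewrite !mxE.
  have mxZ a (A : 'M[R]_1) : (a *: A) 0 0 = a * A 0 0 by rewrite mxE.
  rewrite !(mxB, mxZ) vz zw -/c /quad mulmxA.
  by field; rewrite gt_eqF.
by rewrite subr_ge0 ler_pdivrMr.
Qed.

Lemma trmx_sum_delta (n p : nat) (f : 'I_p -> 'I_n) (a : 'I_p -> R) :
  (\sum_j a j *: delta_mx (f j) 0 : 'cV[R]_n)^T = \sum_j a j *: delta_mx 0 (f j).
Proof.
apply/matrixP => i j; rewrite mxE !summxE.
by apply: eq_bigr => k _; rewrite !mxE andbC.
Qed.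

Lemma quad_sum_delta (n p : nat) (S : 'M[R]_n) (f : 'I_p -> 'I_n) (a : 'I_p -> R) :
  quad S (\sum_j a j *: delta_mx (f j) 0) =
  \sum_i \sum_j a i * a j * S (f i) (f j).
Proof.
rewrite /quad trmx_sum_delta mulmx_suml mulmx_suml summxE; apply: eq_bigr => i _.
rewrite mulmx_sumr summxE; apply: eq_bigr => j _.
rewrite -!(scalemxAl, scalemxAr) -rowE -colE !mxE.
by ring.
Qed.

Lemma dot_sum_delta (n p : nat) (z : 'cV[R]_n) (f : 'I_p -> 'I_n) (a : 'I_p -> R) :
  ((\sum_j a j *: delta_mx (f j) 0 : 'cV[R]_n)^T *m z) 0 0 = \sum_j a j * z (f j) 0.
Proof.
rewrite trmx_sum_delta mulmx_suml summxE; apply: eq_bigr => j _.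
by rewrite -scalemxAl -rowE !mxE.
Qed.

Lemma quad_Sigma_gt0 (K : R -> R) (n : nat) (x : 'cV[R]_n) :
  positive_definite K -> x != 0 -> 0 < quad (Sigma K n) x.
Proof.
move=> [_ Kpd] x0; rewrite quadE.
have [n0|n_gt0] := posnP n.
  case/eqP: x0; apply/matrixP => i j; exfalso.
  by have := leq_ltn_trans (leq0n i) (ltn_ord i); rewrite n0.
under eq_bigr do under eq_bigr do rewrite mxE mulrBl.
apply: (Kpd n (fun i => i.+1%:R / n%:R) (fun i => x i 0)).
  move=> i j /(congr1 (fun u => u * n%:R)).
  rewrite !divfK ?pnatr_eq0 -?lt0n// => /eqP; rewrite eqr_nat eqSS => /eqP ij.
  exact: val_inj.
apply: contrapT => /forallNP x0'; case/eqP: x0; apply/matrixP => i j.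
by rewrite !ord1 [RHS]mxE; apply/eqP; move/negP: (x0' i); rewrite negbK.
Qed.

Lemma Sigma_sym (K : R -> R) (n : nat) :
  positive_definite K -> (Sigma K n)^T = Sigma K n.
Proof.
move=> [Keven _]; apply/matrixP => i j; rewrite !mxE -Keven; congr K.
by rewrite -mulNr opprB.
Qed.

Lemma Sigma_unitmx (K : R -> R) (n : nat) :
  positive_definite K -> Sigma K n \in unitmx.
Proof.
move=> Kpd; rewrite -row_free_unit -kermx_eq0; apply/rowV0P => v /sub_kermxP vS.
apply/eqP; apply: contraT => v0.
have vT0 : v^T != 0 by rewrite -trmx0 (inj_eq (@trmx_inj _ _ _)).
have := quad_Sigma_gt0 Kpd vT0.
by rewrite /quad trmxK vS mul0mx mxE ltxx.
Qed.

Lemma quad_invmx (n : nat) (S : 'M[R]_n) (z : 'cV[R]_n) :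
  S^T = S -> S \in unitmx -> quad (invmx S) z = quad S (invmx S *m z).
Proof.
by move=> Ss Su; rewrite /quad trmx_mul trmx_inv Ss -!mulmxA (mulmxA S) mulmxV// mul1mx.
Qed.

Lemma quad_invSigma_gt0 (K : R -> R) (n : nat) (z : 'cV[R]_n) :
  positive_definite K -> z != 0 -> 0 < quad (invmx (Sigma K n)) z.
Proof.
move=> Kpd z0; rewrite quad_invmx ?Sigma_sym ?Sigma_unitmx//.
apply: quad_Sigma_gt0 => //; apply: contra z0 => /eqP iz0.
by rewrite -(mulKVmx (Sigma_unitmx n Kpd) z) iz0 mulmx0.
Qed.

Lemma zeta_neq0 (n t : nat) : (0 < n)%N -> zeta R n t != 0.
Proof.
case: n => // n _; apply/eqP => /matrixP/(_ ord0 0); rewrite !mxE.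
by case: ifP => _ /eqP; rewrite ?oppr_eq0 oner_eq0.
Qed.

(** The true order is $4^m/\sqrt m$; a loss polynomial in $m$ is harmless here
    and makes the induction immediate. *)
Lemma central_bin_ge (m : nat) : (4 ^ m <= (2 * m).+1 * 'C(2 * m, m))%N.
Proof.
elim: m => // m IH.
have E1 : ((2 * m).+1 * 'C(2 * m, m) = m.+1 * 'C((2 * m).+1, m.+1))%N.
  exact: (mul_bin_diag (2 * m).+1 m).
have E2 : ('C((2 * m).+1, m) = 'C((2 * m).+1, m.+1))%N.
  rewrite -bin_sub; first by congr 'C(_, _); lia.
  by lia.
have -> : (2 * m.+1 = (2 * m).+2)%N by lia.
rewrite binS E2 expnS.
apply: (@leq_trans (4 * (m.+1 * 'C((2 * m).+1, m.+1)))%N).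
  by rewrite -E1 leq_mul2l.
nia.
Qed.

Lemma sqr_le_exp4 (m : nat) : ((2 * m.+1).+1 ^ 2 <= 9 * 4 ^ m)%N.
Proof.
elim: m => // m; rewrite (expnS 4) -!mulnn => IH.
by move: (4 ^ m)%N IH => p; nia.
Qed.
End Information.

Section InformationBound.
Context {R : realType}.
Notation mu := (@lebesgue_measure R).

(** The weights sum to $0$, so that weighting them by a sign change is twice
    an alternating partial sum of binomial coefficients. Stopping in the middle
    of an odd row makes it a central coefficient. *)
Lemma diff_coef_sign_change (m : nat) :
  \sum_(j < (2 * m).+2) diff_coef (2 * m).+1 j * (if (j <= m)%N then -1 else 1)
  = - 2 * ((-1) ^+ m * 'C(2 * m, m)%:R) :> R.
Proof.
have sE (j : 'I_(2 * m).+2) :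
    diff_coef (2 * m).+1 j * (if (j <= m)%N then -1 else 1) =
    diff_coef (2 * m).+1 j + (- 2) * (if (j < m.+1)%N then diff_coef (2 * m).+1 j else 0) :> R.
  by rewrite ltnS; case: ifP => _; ring.
under eq_bigr do rewrite sE.
rewrite big_split/= sum_diff_coef add0r -mulr_sumr -big_mkcond/=.
rewrite -(@big_ord_widen _ _ _ m.+1 (2 * m).+2 (fun j => diff_coef (2 * m).+1 j)); last by lia.
by rewrite partial_sum_diff_coef.
Qed.

(** The test vector is the difference of odd order $2m+1$ whose middle lies
    on the jump; the two conditions on $t$ leave room for its support. The
    powers $16^m$ of its signal and of its variance cancel, and what remains of
    order $m$ is absorbed by $4^{-\nu}$. *)
Lemma information_ge (K : R -> R) (nu : R) (n t : nat) :
  continuous K -> mu.-integrable setT (EFin \o K) -> positive_definite K ->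
  0 < nu -> (spectral_bound K nu < +oo)%E ->
  ((Num.truncn nu).+2 <= t)%N -> ((Num.truncn nu).+1 + t < n)%N ->
  n%:R `^ (2 * nu) <=
  9 * (fine (spectral_bound K nu) * (1 + nu^-1)) *
  quad (invmx (Sigma K n)) (zeta R n t).
Proof.
move=> cK Ki Kpd nu0 Koo.
set m := (Num.truncn nu).+1 => mt mn.
have n0 : (0 < n)%N by lia.
have N0 : 0 < n%:R :> R by rewrite ltr0n.
have CK0 : 0 <= fine (spectral_bound K nu) by rewrite fine_ge0// spectral_bound_ge0.
have fP (j : 'I_(2 * m).+2) : (t - m.+1 + j < n)%N by have := ltn_ord j; lia.
(* Coordinate $m$ of the difference is the last one before the jump. *)
pose f j := Ordinal (fP j).
pose a (j : 'I_(2 * m).+2) : R := diff_coef (2 * m).+1 j.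
pose v : 'cV[R]_n := \sum_j a j *: delta_mx (f j) 0.
have := dot_sqr_le_quad v (Sigma_sym n Kpd) (Sigma_unitmx n Kpd) _
  (quad_invSigma_gt0 Kpd (zeta_neq0 t n0)).
have Spos x : 0 <= quad (Sigma K n) x.
  have [->|x0] := eqVneq x 0; first by rewrite /quad mulmx0 mxE.
  exact/ltW/quad_Sigma_gt0.
move=> /(_ Spos); set q := quad _ (zeta _ _ _).
have q0 : 0 < q by apply: quad_invSigma_gt0 => //; exact: zeta_neq0.
rewrite dot_sum_delta.
have -> : \sum_j a j * zeta R n t (f j) 0 = - 2 * ((-1) ^+ m * 'C(2 * m, m)%:R).
  have ze j : zeta R n t (f j) 0 = if (j <= m)%N then -1 else 1.
    by rewrite mxE /= (_ : (_ <= t)%N = (j <= m)%N)//; lia.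
  by under eq_bigr do rewrite ze; exact: diff_coef_sign_change.
have -> : (- 2 * ((-1) ^+ m * 'C(2 * m, m)%:R)) ^+ 2 = 4 * 'C(2 * m, m)%:R ^+ 2 :> R.
  transitivity (4 * ((-1) ^+ m) ^+ 2 * 'C(2 * m, m)%:R ^+ 2 : R); first by ring.
  by rewrite sqrr_sign mulr1.
have vS : quad (Sigma K n) v <= fine (spectral_bound K nu) * 4 ^+ (2 * m).+1 *
    ((2 * n%:R) `^ (- (2 * nu)) * (1 + (2 * nu)^-1)).
  apply: le_trans (finite_difference_variance_le cK Ki nu0 Koo n0 _).
    rewrite quad_sum_delta le_eqVlt; apply/orP; left; apply/eqP.
    apply: eq_bigr => i _; apply: eq_bigr => j _; rewrite mxE /=.
    congr (_ * K _); rewrite -mulrBl; congr (_ / _).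
    by rewrite -!addnS !natrD; ring.
  have := truncn_itv (ltW nu0) => /andP[_ h].
  rewrite -/m in h.
  by rewrite -(natr1 (2 * m)) natrM; lra.
move=> /le_trans/(_ (ler_wpM2r (ltW q0) vS)).
have bin2 : (16 : R) ^+ m <= (2 * m).+1%:R ^+ 2 * 'C(2 * m, m)%:R ^+ 2.
  rewrite -exprMn -natrM (_ : 16 = 4%:R ^+ 2 :> R); last by ring.
  by rewrite exprAC lerXn2r ?nnegrE ?exprn_ge0// -natrX ler_nat central_bin_ge.
have m9 : (2 * m).+1%:R ^+ 2 <= 9 * 4 `^ nu :> R.
  apply: (@le_trans _ _ (9 * 4 ^+ (Num.truncn nu))).
    by rewrite -natrX -(natrX _ 4) -natrM ler_nat sqr_le_exp4.
  rewrite ler_wpM2l// -powR_mulrn//; apply: ler_powR; first by rewrite ler1n.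
  by have /andP[] := truncn_itv (ltW nu0).
have -> : (2 * n%:R : R) `^ (- (2 * nu)) = (4 `^ nu)^-1 * (n%:R `^ (2 * nu))^-1.
  rewrite powRN powRM ?ler0n// invfM; congr (_^-1 * _).
  by rewrite powRrM powR_mulrn//; congr powR; ring.
have p4 : 0 < 4 `^ nu :> R by rewrite powR_gt0.
have pn : 0 < n%:R `^ (2 * nu) :> R by rewrite powR_gt0.
set P := n%:R `^ (2 * nu) in pn *.
set F := 4 `^ nu in p4 m9 *.
set CK := fine _ in CK0 *.
have B0 : 0 < (16 : R) ^+ m by rewrite exprn_gt0.
have -> : (4 : R) ^+ (2 * m).+1 = 4 * 16 ^+ m.
  by rewrite exprS exprM (_ : 4 ^+ 2 = 16 :> R); last by ring.
set B := _ ^+ m in B0 bin2 *; set c2 := 'C(_, _)%:R ^+ 2 in bin2 * => ub.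
have F0 : 0 <= c2 by rewrite sqr_ge0.
have h1 : B <= 9 * F * c2 by apply: le_trans bin2 _; rewrite ler_wpM2r.
have h2 : c2 <= CK * B * (F^-1 / P * (1 + (2 * nu)^-1)) * q.
  rewrite -(@ler_pM2l _ 4)//; apply: le_trans ub _.
  by rewrite le_eqVlt; apply/orP; left; apply/eqP; ring.
have h3 : B <= B / P * (9 * (CK * (1 + (2 * nu)^-1)) * q).
  have h4 : 9 * F * c2 <= 9 * F * (CK * B * (F^-1 / P * (1 + (2 * nu)^-1)) * q).
    by rewrite ler_wpM2l// mulr_ge0// ltW.
  apply: le_trans h1 (le_trans h4 _); rewrite le_eqVlt; apply/orP; left; apply/eqP.
  by field; rewrite !gt_eqF.
have h5 : P <= 9 * (CK * (1 + (2 * nu)^-1)) * q.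
  rewrite -(ler_pM2l (divr_gt0 B0 pn)); apply: le_trans h3.
  by rewrite divfK// gt_eqF.
apply: le_trans h5 _; rewrite ler_wpM2r ?(ltW q0)// ler_wpM2l// ler_wpM2l// lerD2l.
by rewrite lef_pV2 ?posrE ?mulr_gt0// ler_peMl ?ler1n// ltW.
Qed.
End InformationBound.

(** * Concentration of Gaussian variables of given mean and variance *)

Section Gaussian.
Context {R : realType}.
Notation mu := (@lebesgue_measure R).

Lemma measurable_superlevel (d : measure_display) (T : measurableType d)
    (f : T -> R) (r : R) :
  measurable_fun setT f -> measurable [set x | r <= f x].
Proof.
move=> mf; rewrite (_ : [set _ | _] = f @^-1` `[r, +oo[%classic).
  by rewrite -[X in measurable X]setTI; exact: mf.
by apply/seteqP; split => x /=; rewrite in_itv/= andbT.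
Qed.

Lemma measurable_dist_ge (m r : R) : measurable [set x : measurableTypeR R | r <= `|x - m|].
Proof.
by apply: measurable_superlevel; apply: measurableT_comp => //; exact: measurable_funB.
Qed.

(** On each half of the tail, the density at distance $r$ or more from $m$ is at
    most $e^{-r^2/2s^2}$ times the normal density recentred at $m\pm r$, whose
    integral is $1$. *)
Lemma normal_tail_le (m s r : R) : 0 < s -> 0 <= r ->
  (normal_prob m s [set x : measurableTypeR R | r <= `|x - m|]%R <=
   (2 * expR (- (r ^+ 2 / (2 * s ^+ 2))))%:E)%E.
Proof.
move=> s0 r0; set e := expR _.
have sn0 : s != 0 by rewrite gt_eqF.
have mA := measurable_dist_ge m r.
set A := [set _ | _] in mA *.
pose g (x : R) : R := e * normal_pdf (m + r) s x + e * normal_pdf (m - r) s x.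
have gi u := integrableZl measurableT e (integrable_normal_pdf u s).
have ggi : mu.-integrable setT (EFin \o g).
  exact: (integrableD measurableT (gi (m + r)) (gi (m - r))).
have g0 x : 0 <= g x by rewrite addr_ge0// mulr_ge0 ?expR_ge0 ?normal_pdf_ge0.
have mg : measurable_fun setT (EFin \o g) by case/integrableP : ggi.
have key (u x : R) : r <= u * (x - m) -> u ^+ 2 = 1 ->
    normal_pdf m s x <= e * normal_pdf (m + u * r) s x.
  move=> ru u1; rewrite !normal_pdfE// mulrCA ler_wpM2l ?normal_peak_ge0//.
  rewrite /normal_fun /e -expRD ler_expR -[s ^+ 2 *+ 2]mulr_natl.
  rewrite !mulNr -opprD lerN2 -mulrDl ler_wpM2r//.
    by rewrite invr_ge0 mulr_ge0// sqr_ge0.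
  have -> : (x - (m + u * r)) ^+ 2 = (x - m) ^+ 2 - 2 * r * (u * (x - m)) + u ^+ 2 * r ^+ 2.
    by ring.
  rewrite u1; nra.
apply: (@le_trans _ _ (\int[mu]_(x in A) (g x)%:E)%E).
  apply: ge0_le_integral => //.
  - by move=> x _; rewrite lee_fin normal_pdf_ge0.
  - by apply/measurable_EFinP; apply: measurable_funTS; exact: measurable_normal_pdf.
  - exact: measurable_funTS.
  move=> x Ax; rewrite lee_fin /g.
  have Ax' : r <= `|x - m| by exact: Ax.
  have [xm|xm] := leP 0 (x - m).
    rewrite ger0_norm// in Ax'.
    apply: (@le_trans _ _ (e * normal_pdf (m + r) s x)).
      by have := @key 1 x; rewrite !mul1r expr1n; exact.
    by rewrite lerDl mulr_ge0 ?expR_ge0 ?normal_pdf_ge0.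
  rewrite ltr0_norm// in Ax'.
  apply: (@le_trans _ _ (e * normal_pdf (m - r) s x)).
    by have := @key (-1) x; rewrite !mulN1r sqrrN expr1n; exact.
  by rewrite lerDr mulr_ge0 ?expR_ge0 ?normal_pdf_ge0.
apply: (@le_trans _ _ (\int[mu]_x (g x)%:E)%E).
  by apply: ge0_subset_integral => //= x _; rewrite lee_fin.
rewrite le_eqVlt; apply/orP; left; apply/eqP.
have -> : (\int[mu]_x (g x)%:E = \int[mu]_x (e%:E * (normal_pdf (m + r) s x)%:E) +
   \int[mu]_x (e%:E * (normal_pdf (m - r) s x)%:E))%E.
  by rewrite -integralD//; exact: gi.
rewrite !integralZl//; [|exact: integrable_normal_pdf..].
by rewrite !integral_normal_pdf !mule1 -EFinD; congr EFin; ring.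
Qed.

Lemma normal_peak_le (s : R) : 0 < s -> normal_peak s <= (2 * s)^-1.
Proof.
move=> s0; rewrite /normal_peak lef_pV2 ?posrE ?mulr_gt0//; last first.
  by rewrite sqrtr_gt0 mulrn_wgt0// mulr_gt0 ?exprn_gt0// pi_gt0.
have -> : 2 * s = Num.sqrt ((2 * s) ^+ 2) by rewrite sqrtr_sqr ger0_norm// mulr_ge0// ltW.
rewrite ler_wsqrtr// exprMn.
have : 2 <= pi :> R by exact: pi_ge2.
have : 0 < s ^+ 2 by rewrite exprn_gt0.
rewrite -mulr_natr; nra.
Qed.

(** Anticoncentration: the density is at most $1/(2s)$. *)
Lemma normal_near_le (m s c : R) : 0 < s ->
  (normal_prob m s [set x : measurableTypeR R | `|x - c| < s / 2]%R <= (2^-1)%:E)%E.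
Proof.
move=> s0.
have sn0 : s != 0 by rewrite gt_eqF.
have AE : [set x : measurableTypeR R | `|x - c| < s / 2] = `]c - s / 2, c + s / 2[%classic.
  by apply/seteqP; split => x /=; rewrite in_itv/= ltr_distl.
rewrite AE /normal_prob.
apply: (@le_trans _ _ (\int[mu]_(x in `](c - s / 2)%R, (c + s / 2)%R[) ((2 * s)^-1)%:E)%E).
  apply: ge0_le_integral => //.
  - by move=> x _; rewrite lee_fin normal_pdf_ge0.
  - by apply/measurable_EFinP; apply: measurable_funTS; exact: measurable_normal_pdf.
  - by move=> x _; rewrite lee_fin (le_trans (normal_pdf_ub _ _ sn0))// normal_peak_le.
rewrite integral_cst//= lebesgue_measure_itv/= lte_fin.
rewrite (_ : c - s / 2 < c + s / 2) -?EFinB -?EFinM; last lra.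
by rewrite lee_fin le_eqVlt; apply/orP; left; apply/eqP; field.
Qed.
End Gaussian.

Section Concentration.
Context {R : realType} {d : measure_display} {T : measurableType d}.
Variable P : probability T R.
Local Notation mu := (@lebesgue_measure R).

Lemma Lfun2D (X Y : T -> R) : X \in Lfun P 2%:E -> Y \in Lfun P 2%:E ->
  X \+ Y \in Lfun P 2%:E.
Proof. by move=> X2 Y2; rewrite rpredD ?lee1n. Qed.

(** A stationary covariance gives a finite variance; square integrability is
    what linearity of expectation and bilinearity of covariance need. *)
Lemma Lfun2_of_variance (X : T -> R) : measurable_fun setT X ->
  (variance P X < +oo)%E -> X \in Lfun P 2%:E.
Proof.
move=> mX; rewrite /variance unlock => vX.
set c := fine _ in vX.
have -> : X = (X \- cst c) \+ cst c by apply/funext => x /=; rewrite subrK.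
apply: Lfun2D; last exact: Lfun_cst.
rewrite inE; apply/andP; split.
  by rewrite inE; exact: measurable_funB.
rewrite inE /= /finite_norm unlock poweR_lty//.
apply: le_lt_trans vX; rewrite unlock le_eqVlt; apply/orP; left; apply/eqP.
apply: eq_integral => x _ /=.
by rewrite powR_mulrn// real_normK ?num_real.
Qed.

Section LinearCombination.
Variables (I : Type) (a : I -> R) (X : I -> T -> R).
Hypothesis X2 : forall i, X i \in Lfun P 2%:E.

Let scaledE i : (fun w => a i * X i w) = a i \o* X i.
Proof. by apply/funext => w /=; rewrite mulrC. Qed.

Lemma Lfun2_lincomb (r : seq I) : (fun w => \sum_(i <- r) a i * X i w) \in Lfun P 2%:E.
Proof.
elim: r => [|i r IH].
  by under eq_fun do rewrite big_nil; exact: Lfun_cst.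
under eq_fun do rewrite big_cons.
apply: (Lfun2D (X := fun w => a i * X i w) _ IH).
by rewrite scaledE Lfun_scale// ler1n.
Qed.

Lemma expectation_lincomb (m : I -> R) (r : seq I) :
  (forall i, expectation P (X i) = (m i)%:E) ->
  expectation P (fun w => \sum_(i <- r) a i * X i w) = (\sum_(i <- r) a i * m i)%:E.
Proof.
have Pfin : P setT \is a fin_num := fin_num_measure P _ measurableT.
move=> Xm; elim: r => [|i r IH].
  by under eq_fun do rewrite big_nil; rewrite expectation_cst big_nil.
under eq_fun do rewrite big_cons.
have X1 j : X j \in Lfun P 1 by exact: Lfun_subset12.
have S1 := Lfun_subset12 Pfin (Lfun2_lincomb r).
rewrite (expectationD (X := fun w => a i * X i w)) ?IH//; last first.
  by rewrite scaledE Lfun_scale.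
by rewrite scaledE expectationZl// Xm -EFinM -EFinD big_cons.
Qed.

Lemma covariance_lincomb_l (Y : T -> R) (c : I -> R) (r : seq I) : Y \in Lfun P 2%:E ->
  (forall i, covariance P (X i) Y = (c i)%:E) ->
  covariance P (fun w => \sum_(i <- r) a i * X i w) Y = (\sum_(i <- r) a i * c i)%:E.
Proof.
have Pfin : P setT \is a fin_num := fin_num_measure P _ measurableT.
move=> Y2 Xc; elim: r => [|i r IH].
  by under eq_fun do rewrite big_nil; rewrite covariance_cst_l big_nil.
under eq_fun do rewrite big_cons.
have S2 := Lfun2_lincomb r.
rewrite (covarianceDl (X := fun w => a i * X i w)) ?IH//; last first.
  by rewrite scaledE Lfun_scale// ler1n.
rewrite scaledE covarianceZl ?Xc -?EFinM -?EFinD ?big_cons//.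
- exact: Lfun_subset12.
- exact: Lfun_subset12.
- exact: Lfun2_mul_Lfun1.
Qed.

End LinearCombination.

Lemma variance_lincomb (I : Type) (a : I -> R) (X : I -> T -> R) (c : I -> I -> R) (r : seq I) :
  (forall i, X i \in Lfun P 2%:E) ->
  (forall i j, covariance P (X i) (X j) = (c i j)%:E) ->
  variance P (fun w => \sum_(i <- r) a i * X i w) =
  (\sum_(i <- r) \sum_(j <- r) a i * a j * c i j)%:E.
Proof.
move=> X2 Xc; rewrite /variance.
rewrite (covariance_lincomb_l a X2 (c := fun i => \sum_(j <- r) a j * c i j)).
- by congr EFin; apply: eq_bigr => i _; rewrite mulr_sumr; apply: eq_bigr => j _; rewrite mulrA.
- exact: Lfun2_lincomb.
- move=> i; rewrite covarianceC (covariance_lincomb_l a X2 (c := c i))// => j.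
  by rewrite covarianceC.
Qed.

(** Any upper bound on the standard deviation will do, also for a point mass. *)
Lemma gaussian_law_tail_le (m s sigma : R) : 0 <= s -> s <= sigma -> 0 < sigma ->
  forall r, 0 < r ->
  (gaussian_law m s [set x : measurableTypeR R | r <= `|x - m|]%R <=
   (2 * expR (- (r ^+ 2 / (2 * sigma ^+ 2))))%:E)%E.
Proof.
move=> s0 ss sg0 r r0; rewrite /gaussian_law.
case: ifPn => [_|sn0].
  rewrite diracE memNset; first by rewrite lee_fin mulr_ge0// expR_ge0.
  by rewrite /= subrr normr0 leNgt r0.
have {}s0 : 0 < s by rewrite lt_def sn0.
apply: le_trans (normal_tail_le m s0 (ltW r0)) _.
rewrite lee_fin ler_wpM2l// ler_expR lerN2 ler_wpM2l ?sqr_ge0//.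
rewrite lef_pV2 ?posrE ?mulr_gt0 ?exprn_gt0// ler_wpM2l//.
by rewrite lerXn2r// nnegrE ltW.
Qed.

(** The parameters of the law are pinned down, up to constant factors, by the
    mean and the variance. Chebyshev's inequality and anticoncentration give
    $s^2 \le 8v$; Chebyshev's inequality and the normal tail, two events of total
    probability less than $1$, leave a point within $2\sqrt v$ of the mean and
    $6\sqrt v$ of the centre. A point at distance $r \ge 16\sqrt v$ from the mean
    is then at distance at least $r/2$ from the centre. *)
Lemma gaussian_concentration (X : {mfun T >-> R}) (m v L r : R) :
  gaussian_rv P X -> expectation P X = m%:E -> variance P X = v%:E ->
  0 < v -> 1 <= L -> 0 <= r -> 256 * (v * L) <= r ^+ 2 ->
  (P [set w | r <= `|X w - m|]%R <= (2 * expR (- L))%:E)%E.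
Proof.
move=> [c [s [s0 Xlaw]]] Xm Xv v0 L1 r0 rL.
have mX (e u : R) : measurable [set w | e <= `|X w - u|].
  apply: measurable_superlevel; apply: measurableT_comp => //.
  exact: measurable_funB.
have cheb (e : R) : 0 < e -> (P [set w | e <= `|X w - m|]%R <= (v / e ^+ 2)%:E)%E.
  move=> e0; have := @chebyshev _ _ _ P X e e0; rewrite Xm Xv /= -EFinM mulrC.
  exact.
have tail (sigma e : R) : s <= sigma -> 0 < sigma -> 0 < e ->
    (P [set w | e <= `|X w - c|]%R <= (2 * expR (- (e ^+ 2 / (2 * sigma ^+ 2))))%:E)%E.
  move=> ss sg0 e0; rewrite -[X in P X]/(X @^-1` [set x : measurableTypeR R | e <= `|x - c|]).
  rewrite Xlaw; last exact: measurable_dist_ge.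
  exact: gaussian_law_tail_le.
have sv : s ^+ 2 <= 8 * v.
  have [->|sn0] := eqVneq s 0; first by rewrite expr0n mulr_ge0// ltW.
  have s_gt0 : 0 < s by rewrite lt_def sn0.
  have s2_gt0 : 0 < s / 2 by rewrite divr_gt0.
  have near := normal_near_le c m s_gt0.
  have far := cheb _ s2_gt0.
  pose A := [set w | s / 2 <= `|X w - m|].
  pose B : set (measurableTypeR R) := [set x : R | `|x - m| < s / 2].
  have PA : (P A = 1 - P (X @^-1` B))%E.
    have -> : X @^-1` B = ~` A.
      by apply/seteqP; split => w; rewrite /A /B /= ltNge => /negP.
    rewrite probability_setC; last exact: mX.
    have : P A \is a fin_num by apply: fin_num_measure; exact: mX.
    by case: (P A) => //= x _; rewrite -!EFinB; congr EFin; ring.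
  have mB : measurable B.
    rewrite (_ : B = ~` [set x : measurableTypeR R | s / 2 <= `|x - m|]).
      by apply: measurableC; exact: measurable_dist_ge.
    by apply/seteqP; split => w; rewrite /B /= ltNge => /negP.
  move: PA; rewrite (Xlaw _ mB) /gaussian_law (negbTE sn0) => PA.
  have : ((2^-1)%:E <= (v / (s / 2) ^+ 2)%:E)%E.
    apply: le_trans far; rewrite -/A PA.
    rewrite (_ : 2^-1 = 1 - 2^-1); last by field.
    by rewrite EFinB leeB.
  rewrite lee_fin ler_pdivlMr ?exprn_gt0// expr_div_n.
  by lra.
pose sigma := 3 * Num.sqrt v.
have sq0 : 0 < Num.sqrt v by rewrite sqrtr_gt0.
have sqv : Num.sqrt v ^+ 2 = v by rewrite sqr_sqrtr// ltW.
have sg0 : 0 < sigma by rewrite mulr_gt0.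
have ssg : s <= sigma.
  rewrite -(@ler_pXn2r _ 2)// ?nnegrE ?(ltW sg0)//.
  by rewrite exprMn sqv; lra.
have centre : `|m - c| < 8 * Num.sqrt v.
  rewrite ltNge; apply/negP => far.
  have q2 : 0 < 2 * Num.sqrt v by rewrite mulr_gt0.
  have q6 : 0 < 6 * Num.sqrt v by rewrite mulr_gt0.
  have h1 := cheb _ q2.
  have h2 := tail _ _ ssg sg0 q6.
  have : (P setT <= (v / (2 * Num.sqrt v) ^+ 2)%:E +
      (2 * expR (- ((6 * Num.sqrt v) ^+ 2 / (2 * sigma ^+ 2))))%:E)%E.
    apply: le_trans (leeD h1 h2); apply: le_trans (measureU2 _ _ _) => //.
    rewrite le_measure ?inE//; first exact: measurableU.
    move=> w _ /=; have [|wm] := leP (2 * Num.sqrt v) `|X w - m|; first by left.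
    right; have := ler_distD (X w) m c; rewrite [`|m - X w|]distrC; lra.
  rewrite probability_setT -EFinD lee_fin !exprMn sqv.
  have -> : v / (2 ^+ 2 * v) = 4^-1 by field; rewrite gt_eqF.
  have -> : 6 ^+ 2 * v / (2 * (3 ^+ 2 * v)) = 2 by field; rewrite gt_eqF.
  have e2 : expR (- 2) <= 3^-1 :> R.
    rewrite expRN lef_pV2 ?posrE ?expR_gt0//.
    by have := expR_ge1Dx (2 : R); lra.
  by lra.
have rq : 16 * Num.sqrt v <= r.
  rewrite -(@ler_pXn2r _ 2)// ?nnegrE ?mulr_ge0// ?sqrtr_ge0// exprMn sqv.
  have : v <= v * L by rewrite ler_peMr// ltW.
  lra.
have r2 : 0 < r / 2 by lra.
apply: le_trans (_ : (P [set w | r / 2 <= `|X w - c|]%R <= _)%E).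
  rewrite le_measure ?inE// => w /= rw.
  by have := ler_distD c (X w) m; rewrite [`|c - m|]distrC; lra.
apply: le_trans (tail _ _ ssg sg0 r2) _.
rewrite lee_fin ler_wpM2l// ler_expR lerN2 /sigma !exprMn sqv.
rewrite ler_pdivlMr ?mulr_gt0//.
have : 0 < v * L by rewrite mulr_gt0// (lt_le_trans ltr01).
lra.
Qed.
End Concentration.

(** * The likelihood ratio scores *)

Section Scores.
Context {R : realType}.

(** The statistic at $t$ is the square of the linear functional with these
    weights, normalized to have variance $1$. *)
Definition score_weights (n : nat) (S : 'M[R]_n) (z : 'cV[R]_n) : 'cV[R]_n :=
  (Num.sqrt (quad (invmx S) z))^-1 *: (invmx S *m z).

Lemma quad_score_weights (n : nat) (S : 'M[R]_n) (z : 'cV[R]_n) :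
  S^T = S -> S \in unitmx -> 0 < quad (invmx S) z ->
  quad S (score_weights S z) = 1.
Proof.
move=> Ss Su q0; set a := (Num.sqrt (quad (invmx S) z))^-1.
have -> : quad S (score_weights S z) = a ^+ 2 * quad S (invmx S *m z).
  rewrite !quadE mulr_sumr; apply: eq_bigr => i _; rewrite mulr_sumr.
  by apply: eq_bigr => j _; rewrite !mxE -/a; ring.
rewrite -quad_invmx// /a exprVn sqr_sqrtr ?(ltW q0)// mulVf// gt_eqF//.
Qed.

Lemma score_weights_dot (n : nat) (S : 'M[R]_n) (z x : 'cV[R]_n) :
  S^T = S ->
  \sum_k score_weights S z k 0 * x k 0 =
  (z^T *m invmx S *m x) 0 0 / Num.sqrt (quad (invmx S) z).
Proof.
move=> Ss; have -> : z^T *m invmx S = (invmx S *m z)^T by rewrite trmx_mul trmx_inv Ss.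
by rewrite mxE mulr_suml; apply: eq_bigr => k _; rewrite !mxE; ring.
Qed.

Lemma score_weights_dot_self (n : nat) (S : 'M[R]_n) (z : 'cV[R]_n) :
  S^T = S -> 0 < quad (invmx S) z ->
  \sum_k score_weights S z k 0 * z k 0 = Num.sqrt (quad (invmx S) z).
Proof.
move=> Ss q0; rewrite score_weights_dot// -/(quad _ _) -[X in X / _](sqr_sqrtr (ltW q0)).
by rewrite expr2 mulfK// gt_eqF// sqrtr_gt0.
Qed.

Lemma design_point_in01 (n : nat) (k : 'I_n) : (k.+1%:R / n%:R : R) \in `[0, 1].
Proof.
have n0 : (0 < n)%N by exact: leq_ltn_trans (ltn_ord k).
by rewrite in_itv/= divr_ge0//= ler_pdivrMr ?ltr0n// mul1r ler_nat.
Qed.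

Lemma observations_concentration (d : measure_display) (T : measurableType d)
    (P : probability T R) (G : R -> {mfun T >-> R}) (K : R -> R) (n : nat)
    (c mean : 'cV[R]_n) (L r : R) :
  gaussian_process P G -> stationary_covariance P G K ->
  (forall k : 'I_n, expectation P (G (k.+1%:R / n%:R)) = (mean k 0)%:E) ->
  quad (Sigma K n) c = 1 -> 1 <= L -> 0 <= r -> 256 * L <= r ^+ 2 ->
  (P [set w | r <= `|(\sum_k c k 0 * observations G n w k 0)
                     - \sum_k c k 0 * mean k 0|]%R <= (2 * expR (- L))%:E)%E.
Proof.
move=> Gg Gcov Gm c1 L1 r0 rL.
pose X (k : 'I_n) : T -> R := G (k.+1%:R / n%:R).
have Xcov i j : covariance P (X i) (X j) = (Sigma K n i j)%:E.
  rewrite /X Gcov ?design_point_in01//; congr (_%:E).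
  by rewrite mxE mulrBl.
have X2 i : X i \in Lfun P 2%:E.
  apply: Lfun2_of_variance; first exact: measurable_funP.
  by rewrite /variance Xcov ltry.
have Zg : gaussian_rv P (fun w => \sum_k c k 0 * X k w).
  by apply: Gg => k; exact: design_point_in01.
have mZ : measurable_fun setT (fun w => \sum_k c k 0 * X k w).
  by apply: measurable_sum => k; apply: measurable_funM => //; exact: measurable_funP.
have Zm := expectation_lincomb (fun k => c k 0) X2 (index_enum _) Gm.
have Zv := variance_lincomb (fun k => c k 0) (index_enum _) X2 Xcov.
rewrite -quadE c1 in Zv.
pose Z : {mfun T >-> R} := HB.pack (fun w => \sum_k c k 0 * X k w)
  (isMeasurableFun.Build _ _ _ _ _ mZ).
have := @gaussian_concentration _ _ _ P Z _ _ L r Zg Zm Zv ltr01 L1 r0.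
rewrite mul1r => /(_ rL); congr (P _ <= _)%E; apply/funext => w /=.
have -> // : \sum_k c k 0 * observations G n w k 0 = \sum_k c k 0 * X k w.
by apply: eq_bigr => k _; rewrite mxE.
Qed.
End Scores.

Section Thresholding.
Context {R : realType}.

Lemma glrt_statE (n t : nat) (S : 'M[R]_n) (x : 'cV[R]_n) : S^T = S ->
  glrt_stat S t x = `|\sum_k score_weights S (zeta R n t) k 0 * x k 0| ^+ 2.
Proof. by move=> Ss; rewrite score_weights_dot. Qed.

Lemma glrtP (n : nat) (alpha thr : R) (S : 'M[R]_n) (x : 'cV[R]_n) : 0 < thr ->
  reflect (exists2 t : 'I_n.+1, candidate n alpha t & thr <= glrt_stat S t x)
          (glrt alpha S thr x).
Proof.
move=> thr0; apply: (iffP idP) => [|[t ct tt]].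
  rewrite /glrt => thrM; apply: contrapT => /forall2NP none.
  move: thrM; apply/negP; rewrite -ltNge; apply: bigmax_lt => // t ct.
  by rewrite ltNge; apply/negP; case: (none t).
by apply: le_trans tt _; apply: (le_bigmax_cond _ (fun t : 'I_n.+1 => glrt_stat S t x)).
Qed.

(** Chosen so that $n+1$ events of probability $2e^{-\ell}$ have total
    probability $\delta/2$. *)
Definition log_level (n : nat) (delta : R) : R := ln (4 * n.+1%:R / delta).

Lemma log_level_arg_ge4 (n : nat) (delta : R) : 0 < delta < 1 -> 4 <= 4 * n.+1%:R / delta.
Proof.
move=> /andP[d0 d1]; rewrite ler_pdivlMr// ler_wpM2l//.
by rewrite (le_trans (ltW d1))// ler1n.
Qed.

Lemma log_level_ge1 (n : nat) (delta : R) : 0 < delta < 1 -> 1 <= log_level n delta.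
Proof.
move=> d01; have h4 := log_level_arg_ge4 n d01.
rewrite -[leLHS]expRK /log_level ler_ln ?posrE ?expR_gt0//; last exact: lt_le_trans h4.
apply: le_trans h4.
(* $e \le 4$, as the square of $e^{1/2} \le 2$. *)
have h : expR (- 2^-1) >= 2^-1 :> R by have := expR_ge1Dx (- 2^-1 : R); lra.
have -> : expR 1 = (expR (- 2^-1) ^+ 2)^-1 :> R.
  by rewrite -expRM_natr -expRN; congr expR; field.
have e0 : 0 < expR (- 2^-1 : R) by exact: expR_gt0.
rewrite -[4]invrK lef_pV2 ?posrE ?exprn_gt0//.
nra.
Qed.

Lemma expR_log_level (n : nat) (delta : R) : 0 < delta < 1 ->
  n.+1%:R * (2 * expR (- log_level n delta)) = delta / 2.
Proof.
move=> d01; have /andP[d0 _] := d01.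
rewrite expRN lnK; last by rewrite posrE; apply: lt_le_trans (log_level_arg_ge4 n d01).
by field; rewrite gt_eqF//= (gt_eqF d0) nat1r pnatr_eq0.
Qed.

(** The union bound runs over $n+1$ indices while the signal condition involves
    $n(1-2\alpha)$. Their logarithms are comparable, because the hypotheses make
    $(n(1-2\alpha))^2$ at least $4(n+1)$. *)
Lemma log_level_le (n : nat) (alpha delta : R) : alpha < 2^-1 -> 0 < delta < 1 ->
  (0 < n)%N -> 8 <= n%:R * (1 - 2 * alpha) ^+ 2 ->
  log_level n delta <= 2 * ln (n%:R * (1 - 2 * alpha) / delta).
Proof.
move=> a2 d01 n0 n8; have /andP[d0 d1] := d01.
have N1 : 1 <= n%:R :> R by rewrite ler1n.
have x0 : 0 < n%:R * (1 - 2 * alpha) / delta.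
  by rewrite divr_gt0// mulr_gt0; lra.
rewrite mulr_natl -lnXn// /log_level ler_ln ?posrE ?exprn_gt0//; last first.
  by apply: lt_le_trans (log_level_arg_ge4 n d01).
rewrite expr_div_n expr2 invfM mulrA ler_wpM2r ?invr_ge0 ?(ltW d0)//.
rewrite ler_pdivlMr// -natr1.
have : 8 * n%:R <= n%:R * (1 - 2 * alpha) ^+ 2 * n%:R by rewrite ler_wpM2r.
nra.
Qed.
End Thresholding.

(** * Error probabilities of the test *)

Section Errors.
Context {R : realType} {d : measure_display} {T : measurableType d}.
Variables (P : probability T R) (G : R -> {mfun T >-> R}) (K : R -> R) (n : nat).
Hypotheses (Gg : gaussian_process P G) (Gcov : stationary_covariance P G K)
  (Kpd : positive_definite K).
Let S := Sigma K n.
Let Ssym : S^T = S := Sigma_sym n Kpd.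

Lemma measurable_functional (c : 'cV[R]_n) :
  measurable_fun setT (fun w => \sum_k c k 0 * observations G n w k 0).
Proof.
apply: measurable_sum => k; apply: measurable_funM => //.
by under eq_fun do rewrite mxE; exact: measurable_funP.
Qed.

Lemma measurable_functional_dist_ge (c : 'cV[R]_n) (m r : R) :
  measurable [set w | r <= `|(\sum_k c k 0 * observations G n w k 0) - m|].
Proof.
apply: measurable_superlevel; apply: measurableT_comp => //.
by apply: measurable_funB => //; exact: measurable_functional.
Qed.

Lemma measurable_glrt_stat_ge (thr : R) (t : nat) :
  measurable [set w | thr <= glrt_stat S t (observations G n w)].
Proof.
apply: measurable_superlevel; under eq_fun do rewrite glrt_statE//.
apply: measurable_funX; apply: measurableT_comp => //.
exact: measurable_functional.
Qed.

Lemma glrt_eventE (alpha thr : R) : 0 < thr ->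
  [set w | glrt alpha S thr (observations G n w)] =
  \big[setU/set0]_(t < n.+1)
    [set w | candidate n alpha t && (thr <= glrt_stat S t (observations G n w))].
Proof.
move=> thr0; rewrite -(bigcup_mkord n.+1 (fun t =>
  [set w | candidate n alpha t && (thr <= glrt_stat S t (observations G n w))])).
apply/seteqP; split => w /=.
  by move=> /(glrtP _ _ _ thr0)[t ct tt]; exists t => //=; rewrite ct.
move=> [t /= tn /andP[ct tt]]; apply/(glrtP _ _ _ thr0).
by exists (Ordinal tn).
Qed.

Lemma measurable_candidate_glrt_stat_ge (alpha thr : R) (t : nat) :
  measurable [set w | candidate n alpha t && (thr <= glrt_stat S t (observations G n w))].
Proof.
case: (candidate n alpha t) => /=; first exact: measurable_glrt_stat_ge.
rewrite (_ : [set _ | _] = set0)//; apply/seteqP; split => //.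
Qed.

Lemma measurable_glrt (alpha thr : R) : 0 < thr ->
  measurable [set w | glrt alpha S thr (observations G n w)].
Proof.
move=> thr0; rewrite glrt_eventE//; apply: bigsetU_measurable => t _.
exact: measurable_candidate_glrt_stat_ge.
Qed.

Hypothesis n0 : (0 < n)%N.
Variables (alpha delta : R).
Hypothesis d01 : 0 < delta < 1.
Let L := log_level n delta.
Let L1 : 1 <= L := log_level_ge1 n d01.
Let thr := 256 * L.
Let thr0 : 0 < thr.
Proof. by rewrite /thr pmulr_rgt0 ?ltr0n// (lt_le_trans ltr01 L1). Qed.

Let q t := quad (invmx S) (zeta R n t).
Let q0 t : 0 < q t := quad_invSigma_gt0 Kpd (zeta_neq0 t n0).

Let score_ge t (x : 'cV[R]_n) : (thr <= glrt_stat S t x) =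
  (Num.sqrt thr <= `|\sum_k score_weights S (zeta R n t) k 0 * x k 0|).
Proof.
rewrite glrt_statE// -{1}(sqr_sqrtr (ltW thr0)).
by rewrite ler_pXn2r// nnegrE sqrtr_ge0.
Qed.

Let score_concentration t (mean : 'cV[R]_n) :
  (forall k : 'I_n, expectation P (G (k.+1%:R / n%:R)) = (mean k 0)%:E) ->
  (P [set w | Num.sqrt thr <=
     `|(\sum_k score_weights S (zeta R n t) k 0 * observations G n w k 0)
       - \sum_k score_weights S (zeta R n t) k 0 * mean k 0|]%R <=
   (2 * expR (- L))%:E)%E.
Proof.
move=> Gm; apply: (observations_concentration Gg Gcov Gm _ L1).
- exact: (quad_score_weights Ssym (Sigma_unitmx n Kpd) (q0 t)).
- exact: sqrtr_ge0.
- by rewrite sqr_sqrtr// ltW.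
Qed.

(** Every score is centred, and [log_level] is tuned to the union bound. *)
Lemma glrt_false_alarm_le :
  (forall k : 'I_n, expectation P (G (k.+1%:R / n%:R)) = 0%E) ->
  (P [set w | glrt alpha S thr (observations G n w)] <= (delta / 2)%:E)%E.
Proof.
move=> Gm; rewrite glrt_eventE//.
have mA := measurable_candidate_glrt_stat_ge alpha thr.
apply: le_trans (Boole_inequality _ (fun t _ => mA t)) _.
apply: (@le_trans _ _ (\sum_(t < n.+1) (2 * expR (- L))%:E)%E).
  apply: lee_sum => t _.
  have Gm0 (k : 'I_n) : expectation P (G (k.+1%:R / n%:R)) = ((0 : 'cV[R]_n) k 0)%:E.
    by rewrite Gm mxE.
  apply: le_trans (score_concentration t Gm0).
  apply: le_measure; rewrite ?inE//.
    exact: measurable_functional_dist_ge.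
  move=> w /= /andP[_]; rewrite score_ge.
  by rewrite [X in _ - X]big1 ?subr0// => k _; rewrite [X in _ * X]mxE mulr0.
by rewrite sumEFin sumr_const card_ord -(expR_log_level n d01) (mulr_natl _ n.+1).
Qed.

(** The mean $\frac b2\sqrt{q_t}$ of the score is at least twice the square root
    of the threshold $256\,\ell$, so that a score below the threshold deviates
    from its mean by at least that square root. *)
Lemma glrt_miss_le (b : R) (t : nat) : candidate n alpha t ->
  (forall k : 'I_n, expectation P (G (k.+1%:R / n%:R)) = (b / 2 * zeta R n t k 0)%:E) ->
  4096 * L <= b ^+ 2 * q t ->
  (P [set w | ~~ glrt alpha S thr (observations G n w)] <= (delta / 2)%:E)%E.
Proof.
move=> ct Gm bq.
have Gmb (k : 'I_n) : expectation P (G (k.+1%:R / n%:R)) = ((b / 2 *: zeta R n t) k 0)%:E.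
  by rewrite Gm [in RHS]mxE.
apply: (@le_trans _ _ (2 * expR (- L))%:E); last first.
  rewrite -(expR_log_level n d01) lee_fin ler_peMl ?mulr_ge0 ?expR_ge0//.
  by rewrite ler1n.
apply: le_trans (score_concentration t Gmb).
apply: le_measure; rewrite ?inE//.
- rewrite (_ : [set _ | _] = ~` [set w | glrt alpha S thr (observations G n w)]).
    by apply: measurableC; exact: measurable_glrt.
  by apply/seteqP; split => w /= /negP.
- exact: measurable_functional_dist_ge.
move=> w /= /glrtP nglrt.
have {nglrt} : ~ (thr <= glrt_stat S t (observations G n w)).
  move=> tt; apply: nglrt => //.
  have tn : (t < n.+1)%N by move: ct => /and3P[_ + _]; rewrite ltnS.
  by exists (Ordinal tn).
rewrite score_ge => /negP; rewrite -ltNge.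
set Z := \sum_k _ => Zthr.
have -> : \sum_k score_weights S (zeta R n t) k 0 * (b / 2 *: zeta R n t) k 0 =
    b / 2 * Num.sqrt (q t).
  rewrite -(score_weights_dot_self Ssym (q0 t)) mulr_sumr; apply: eq_bigr => k _.
  by rewrite !mxE; ring.
have mean2 : 2 * Num.sqrt thr <= `|b / 2 * Num.sqrt (q t)|.
  rewrite -(@ler_pXn2r _ 2)// ?nnegrE ?mulr_ge0 ?sqrtr_ge0//.
  rewrite real_normK ?num_real// !exprMn !sqr_sqrtr ?(ltW thr0) ?(ltW (q0 t))//.
  by rewrite /thr; lra.
have := ler_normB Z (Z - b / 2 * Num.sqrt (q t)).
rewrite opprB addrC subrK; lra.
Qed.

End Errors.

Theorem theorem3p1 (R : realType) :
  exists (C : R) (thr : nat -> R -> R),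
    0 < C /\
    (forall (n : nat) (delta : R), 0 < delta < 1 -> 0 < thr n delta) /\
    forall (alpha : R) (K : R -> R) (nu : R),
      0 < alpha < 2^-1 ->
      continuous K ->
      lebesgue_measure.-integrable [set: R] (EFin \o K) ->
      positive_definite K ->
      0 < nu ->
      (spectral_bound K nu < +oo)%E ->
      exists n0 : nat,
        forall (n : nat) (delta b : R)
          (d : measure_display) (T : measurableType d)
          (G : R -> {mfun T >-> R})
          (P0 : probability T R) (P1 : nat -> probability T R),
          (n0 <= n)%N ->
          0 < delta < 1 ->
          b != 0 ->
          gaussian_process P0 G ->
          stationary_covariance P0 G K ->
          (forall k : 'I_n, expectation P0 (G (k.+1%:R / n%:R)) = 0%E) ->
          (forall t : nat, candidate n alpha t ->
             gaussian_process (P1 t) G /\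
             stationary_covariance (P1 t) G K /\
             forall k : 'I_n,
               expectation (P1 t) (G (k.+1%:R / n%:R))
                 = (b / 2 * zeta R n t k 0)%:E) ->
          C * n%:R `^ (- nu) *
            Num.sqrt (fine (spectral_bound K nu) * (1 + nu^-1) *
                      ln (n%:R * (1 - 2 * alpha) / delta)) <= `|b| ->
          (detection_error P0 P1 alpha (observations G n)
             (glrt alpha (Sigma K n) (thr n delta)) <= delta%:E)%E.
Proof.
(* The bound on $b$ and [information_ge] give $b^2q_t \ge 272^2\ell'/9$ with
   $\ell'$ at least half the level, and $272^2/18 \ge 4096$. *)
exists 272, (fun n delta => 256 * log_level n delta); split; first by rewrite ltr0n.
split=> [n delta d01|].
  by rewrite pmulr_rgt0 ?ltr0n// (lt_le_trans ltr01 (log_level_ge1 n d01)).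
move=> alpha K nu /andP[a0 a2] cK Ki Kpd nu0 Koo.
set m := (Num.truncn nu).+1.
have a12 : 0 < (1 - 2 * alpha) ^+ 2 by rewrite exprn_gt0//; lra.
(* The first term makes room for the difference on both sides of every
   candidate, the second makes the two logarithms comparable. *)
exists (Num.truncn (m.+1%:R / alpha + 8 / (1 - 2 * alpha) ^+ 2)).+1.
move=> n delta b d T G P0 P1 nn0 d01 b0 G0 cov0 mean0 H1 hb.
have n0 : (0 < n)%N by exact: leq_ltn_trans nn0.
have nbig : m.+1%:R / alpha + 8 / (1 - 2 * alpha) ^+ 2 <= n%:R.
  by apply: le_trans (ltW (truncnS_gt _)) _; rewrite ler_nat.
have p1 : 0 <= m.+1%:R / alpha by rewrite divr_ge0// ltW.
have p2 : 0 <= 8 / (1 - 2 * alpha) ^+ 2 by rewrite divr_ge0// ltW.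
have na : m.+1%:R <= alpha * n%:R.
  by rewrite mulrC -ler_pdivrMr//; lra.
have n8 : 8 <= n%:R * (1 - 2 * alpha) ^+ 2.
  by rewrite -ler_pdivrMr//; lra.
have level := log_level_le a2 d01 n0 n8.
set L := log_level n delta in level *.
have L1 : 1 <= L := log_level_ge1 n d01.
rewrite /detection_error (_ : delta = delta / 2 + delta / 2); last by field.
rewrite EFinD leeD//; first exact: glrt_false_alarm_le.
have d0 : 0 < delta / 2 by move/andP: d01 => [? _]; rewrite divr_gt0.
apply: bigmax_le => [|t ct]; first by rewrite lee_fin ltW.
have [Gt [covt meant]] := H1 t ct.
apply: (glrt_miss_le Gt covt Kpd n0 d01 ct meant).
have := ct => /and3P[t1 tn]; rewrite natr_min lt_min => /andP[at1 at2].
have mt : (m.+1 <= t)%N by rewrite -(ler_nat R) (le_trans na)// ltW.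
have mnt : (m.+1 <= n - t)%N by rewrite -(ler_nat R) (le_trans na)// ltW.
have mtn : (m + t < n)%N by rewrite addnC -ltn_subRL.
have info := information_ge cK Ki Kpd nu0 Koo mt mtn.
set q := quad _ _ in info *.
set CK := fine _ * _ in hb info.
set l := ln _ in hb level.
have q0 : 0 < q by apply: quad_invSigma_gt0 => //; exact: zeta_neq0.
have CK0 : 0 <= CK.
  rewrite mulr_ge0 ?fine_ge0 ?spectral_bound_ge0// addr_ge0// invr_ge0 ltW//.
have l0 : 0 <= l by lra.
have pn : 0 < n%:R `^ nu :> R by rewrite powR_gt0// ltr0n.
have b2 : 272 ^+ 2 * (CK * l) <= b ^+ 2 * (n%:R `^ nu) ^+ 2.
  rewrite -[b ^+ 2]real_normK ?num_real// -exprMn.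
  have h : 272 * Num.sqrt (CK * l) <= `|b| * n%:R `^ nu.
    move: hb; rewrite powRN mulrAC ler_pdivrMr//.
  have -> : 272 ^+ 2 * (CK * l) = (272 * Num.sqrt (CK * l)) ^+ 2.
    by rewrite exprMn sqr_sqrtr// mulr_ge0.
  by rewrite ler_pXn2r// nnegrE mulr_ge0 ?sqrtr_ge0// ltW.
have nu2 : n%:R `^ (2 * nu) = (n%:R `^ nu) ^+ 2 :> R.
  by rewrite mulrC powRrM powR_mulrn// ltW.
rewrite nu2 in info.
set N2 := _ ^+ 2 in info b2.
have N20 : 0 < N2 by rewrite exprn_gt0.
have h1 : 272 ^+ 2 * l * N2 <= 272 ^+ 2 * l * (9 * CK * q).
  by rewrite ler_wpM2l// mulr_ge0// exprn_ge0.
have h2 : 9 * q * (272 ^+ 2 * (CK * l)) <= 9 * q * (b ^+ 2 * N2).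
  by rewrite ler_wpM2l// mulr_ge0// ltW.
have h3 : 272 ^+ 2 * l <= 9 * (b ^+ 2 * q).
  rewrite -(ler_pM2r N20); apply: le_trans h1 _.
  apply: le_trans (_ : 9 * q * (b ^+ 2 * N2) <= _); last first.
    by rewrite le_eqVlt; apply/orP; left; apply/eqP; ring.
  by apply: le_trans h2; rewrite le_eqVlt; apply/orP; left; apply/eqP; ring.
by rewrite -/L -/q; clear -h3 level L1; lra.
Qed.
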